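(* Let $\Phi$ be a regular root system in $E$ and $\Gamma$ a group that is strongly graded by $\Phi$, with root subgroups $\{K_\alpha\}_{\alpha\in\Phi}$. Also, let $\mathcal{E}$ be a class of uniformly convex Banach spaces such that either $\mathcal{E}$ is closed under passing to ultraproducts or $\mathcal{E}=\mathcal{E}_{uc}$. If for every $\alpha\in\Phi$ the pair $(\Gamma,K_\alpha)$ has relative property $(F_{\mathcal{E}})$, then $\Gamma$ has property $(F_{\mathcal{E}})$.
   Context: Root systems. A root system in a finite dimensional real vector space $E$ is a finite non-empty set $\Phi\subset E$ that spans $E$, does not contain $0$ and satisfies $\Phi=-\Phi$; its rank is $\dim E$. It is irreducible if there are no disjoint non-empty $\Phi_1,\Phi_2$ with $\Phi=\Phi_1\cup\Phi_2$ and $\mathrm{span}(\Phi_1)\cap\mathrm{span}(\Phi_2)=\{0\}$. A non-empty $\Psi\subseteq\Phi$ is a root subsystem if $\Phi\cap\mathrm{span}(\Psi)=\Psi$. $\Phi$ is regular if every root of $\Phi$ is contained in an irreducible root subsystem of rank $2$. Borel sets. A linear functional $f:E\to\mathbb{R}$ is in general position with respect to $\Phi$ if $f(\alpha)\ne0$ for all $\alpha\in\Phi$ and $f(\alpha)\ne f(\beta)$ for all distinct $\alpha,\beta\in\Phi$. For such $f$ the Borel set of $f$ is $\Phi_f=\{\alpha\in\Phi:f(\alpha)>0\}$; $\mathrm{Borel}(\Phi)$ is the set of all Borel sets. $\Phi_1,\Phi_2\in\mathrm{Borel}(\Phi)$ are co-minimal if $\Phi_1\cap\Phi_2$ spans a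 $1$-dimensional space. The boundary of $\Phi_1\in\mathrm{Borel}(\Phi)$ is $\partial\Phi_1=\{\alpha\in\Phi_1:\exists\Phi_2\in\mathrm{Borel}(\Phi)$ co-minimal with $\Phi_1$ such that $\alpha\in\Phi_1\cap\Phi_2\}$, and $\mathrm{Core}(\Phi_1)=\Phi_1\setminus\partial\Phi_1$. Gradings. $\Gamma$ is graded by $\Phi$ if there are subgroups $\{K_\alpha\}_{\alpha\in\Phi}$ of $\Gamma$ with $\langle K_\alpha:\alpha\in\Phi\rangle=\Gamma$ and, for all $\alpha,\beta\in\Phi$ with $\beta\notin\mathbb{R}_{<0}\alpha$, $[K_\alpha,K_\beta]\subseteq\langle K_\gamma:\gamma=a\alpha+b\beta\in\Phi,\ a,b\ge1\rangle$ ($a,b$ real). It is strongly graded by $\Phi$ if moreover for every $\Phi_1\in\mathrm{Borel}(\Phi)$ and every $\beta\in\mathrm{Core}(\Phi_1)$, $K_\beta\subseteq\langle K_\gamma:\gamma\in\Phi_1\setminus(\mathbb{R}_{>0}\beta)\rangle$. Fixed point properties. $\Gamma$ is discrete. $(\Gamma,K)$ has relative property $(F_{\mathbb{E}})$, for a Banach space $\mathbb{E}$ and $K<\Gamma$, if every affine isometric action of $\Gamma$ on $\mathbb{E}$ has a $K$-fixed point; $\Gamma$ has property $(F_{\mathbb{E}})$ if every such action has a $\Gamma$-fixed point; for a class $\mathcal{E}$, (relative) property $(F_{\mathcal{E}})$ means this for all $\mathbb{E}\in\mathcal{E}$. $\mathcal{E}_{uc}$ is the class of all uniformly convex Banach spaces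 ($\mathbb{E}$ is uniformly convex if there is $\delta:(0,2]\to(0,1]$ such that for unit vectors $\xi,\eta$, $\|\xi-\eta\|\ge\varepsilon$ implies $\|\frac{\xi+\eta}{2}\|\le1-\delta(\varepsilon)$). Fix a non-principal ultrafilter $\mathcal{U}$ on $\mathbb{N}$; the ultraproduct of a sequence $\{\mathbb{E}_n\}$ of Banach spaces is the space of bounded sequences $(\xi_n)$, $\xi_n\in\mathbb{E}_n$, modulo those with $\lim_{n\to\mathcal{U}}\|\xi_n\|=0$, with norm $\lim_{n\to\mathcal{U}}\|\xi_n\|$; $\mathcal{E}$ is closed under passing to ultraproducts if ultraproducts of sequences in $\mathcal{E}$ are in $\mathcal{E}$. *)

(* Defs.v *)
From HB Require Import structures.
From mathcomp Require Import all_boot all_order all_algebra.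
From mathcomp Require Import generic_quotient ring_quotient finmap lra.
From mathcomp Require Import all_classical all_reals all_analysis.
Set Implicit Arguments.
Unset Strict Implicit.
Unset Printing Implicit Defensive.
Import Order.TTheory GRing.Theory Num.Theory.
Import numFieldNormedType.Exports.
Local Open Scope classical_set_scope.
Local Open Scope ring_scope.

Section RootSystems.
Local Open Scope fset_scope.
Variables (R : realType) (V : vectType R).
Implicit Types Phi Psi B : {fset V}.

Definition root_system Phi : Prop :=
  [/\ Phi != fset0, <<Phi>>%VS = fullv, 0 \notin Phi &
      forall a, (a \in Phi) = (- a \in Phi)].

Definition irreducible_root_system Phi : Prop :=
  ~ exists Phi1 Phi2 : {fset V},
      [/\ Phi1 != fset0, Phi2 != fset0, [disjoint Phi1 & Phi2]%fset,
          Phi = Phi1 `|` Phi2 & (<<Phi1>> :&: <<Phi2>> = 0)%VS].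

Definition root_subsystem Phi Psi : Prop :=
  [/\ Psi != fset0, Psi `<=` Phi & [fset a in Phi | a \in <<Psi>>%VS] = Psi].

Definition regular_root_system Phi : Prop :=
  forall a, a \in Phi -> exists Psi : {fset V},
    [/\ root_subsystem Phi Psi, irreducible_root_system Psi,
        \dim <<Psi>>%VS = 2%N & a \in Psi].

Definition general_position Phi (f : {linear V -> R^o}) : Prop :=
  (forall a, a \in Phi -> f a != 0) /\
  (forall a b, a \in Phi -> b \in Phi -> a != b -> f a != f b).

Definition Borel_set Phi B : Prop :=
  exists2 f : {linear V -> R^o}, general_position Phi f &
    B = [fset a in Phi | (0 : R) < f a].

Definition co_minimal B1 B2 : Prop := \dim <<B1 `&` B2>>%VS = 1%N.

Definition boundary Phi B1 : {fset V} :=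
  [fset a in B1 | `[< exists B2, [/\ Borel_set Phi B2, co_minimal B1 B2 &
                                     a \in B1 `&` B2] >]].

Definition core Phi B1 : {fset V} := B1 `\` boundary Phi B1.

End RootSystems.

Section Gradings.
Variable G : groupType.
Implicit Types H K : set G.

Definition is_subgroup H : Prop :=
  H 1%g /\ forall x y, H x -> H y -> H (x / y)%g.

Definition generated_subgroup (A : set G) : set G := smallest is_subgroup A.

Definition commutator_subgroup H K : set G :=
  generated_subgroup [set g | exists x y, [/\ H x, K y & g = [~ x, y]%g]].

Variables (R : realType) (V : vectType R).

(* Only the values of [K] on [Phi] are relevant. The commutator
   [[~ x, y]] of MathComp is [x^-1 * y^-1 * x * y]. *)
Definition graded_by (Phi : {fset V}) (K : V -> set G) : Prop :=
  [/\ forall a, a \in Phi -> is_subgroup (K a),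
      generated_subgroup (\bigcup_(a in [set` Phi]) K a) = setT &
      forall a b, a \in Phi -> b \in Phi ->
        ~ (exists2 c : R, c < 0 & b = c *: a) ->
        commutator_subgroup (K a) (K b) `<=`
        generated_subgroup (\bigcup_(g in [set g | g \in Phi /\
          exists s t : R, [/\ 1 <= s, 1 <= t & g = s *: a + t *: b]]) K g)].

Definition strongly_graded_by (Phi : {fset V}) (K : V -> set G) : Prop :=
  graded_by Phi K /\
  forall B b, Borel_set Phi B -> b \in core Phi B ->
    K b `<=` generated_subgroup (\bigcup_(g in [set g | g \in B /\
               ~ exists2 c : R, 0 < c & g = c *: b]) K g).

End Gradings.

Section FixedPoints.
Variables (R : realType) (G : groupType).

Definition affine_isometry (X : normedModType R) (f : X -> X) : Prop :=
  (exists (L : {linear X -> X}) (b : X), forall x, f x = L x + b) /\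
  (forall x y, `|f x - f y| = `|x - y|).

Definition affine_isometric_action (X : normedModType R) (rho : G -> X -> X) :
    Prop :=
  [/\ forall x, rho 1%g x = x,
      forall g h x, rho (g * h)%g x = rho g (rho h x) &
      forall g, affine_isometry (rho g)].

Definition relative_propertyF (C : completeNormedModType R -> Prop)
    (K : set G) : Prop :=
  forall X : completeNormedModType R, C X ->
  forall rho : G -> X -> X, affine_isometric_action rho ->
  exists x : X, forall g, K g -> rho g x = x.

Definition propertyF (C : completeNormedModType R -> Prop) : Prop :=
  forall X : completeNormedModType R, C X ->
  forall rho : G -> X -> X, affine_isometric_action rho ->
  exists x : X, forall g, rho g x = x.

End FixedPoints.

Definition uniformly_convex (R : realType) (X : normedModType R) : Prop :=
  exists delta : R -> R, forall e : R, 0 < e <= 2 ->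
    0 < delta e <= 1 /\
    forall x y : X, `|x| = 1 -> `|y| = 1 -> e <= `|x - y| ->
      `|2^-1 *: (x + y)| <= 1 - delta e.

Record nonprincipal_ultrafilter := NonprincipalUltrafilter {
  ultrafilter_sets : set_system nat ;
  ultrafilterP : UltraFilter ultrafilter_sets ;
  ultrafilter_nonprincipal : forall n, ~ ultrafilter_sets [set n]
}.
#[global] Existing Instance ultrafilterP.

Section UltrafilterLimits.
Variables (R : realType) (U : nonprincipal_ultrafilter).

Lemma fmap_ultra T (f : nat -> T) : UltraFilter (f @ ultrafilter_sets U).
Proof.
split; first exact: fmap_proper_filter.
move=> G GF sfG; apply/seteqP; split=> [A GA|]; last exact: sfG.
have [//|UA] := in_ultra_setVsetC (f @^-1` A) (ultrafilterP U).
have GnA : G (~` A) by exact: sfG.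
by have /filter_ex[x []] : G (A `&` ~` A) by exact: filterI.
Qed.

Lemma ultralim_cvg (u : nat -> R) (M : R) :
  (forall n, `|u n| <= M) -> cvg (u @ ultrafilter_sets U).
Proof.
move=> uM; have := @segment_compact R (- M) M; rewrite compact_ultra.
move=> /(_ (u @ ultrafilter_sets U) (fmap_ultra u))[|l [_ ul]]; last first.
  by apply/cvg_ex; exists l.
apply: (@filterE _ (ultrafilter_sets U)) => n /=.
by rewrite in_itv/= -ler_norml.
Qed.

Lemma ultrafilter_ge k : ultrafilter_sets U [set n | (k <= n)%N].
Proof.
elim: k => [|k IH]; first exact: filterE.
have [/(ultrafilter_nonprincipal)//|Uk] :=
  in_ultra_setVsetC [set k] (ultrafilterP U).
by apply: filterS2 IH Uk => n /= kn /eqP; rewrite ltn_neqAle kn eq_sym andbT.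
Qed.

Lemma ultrafilter_forall_leq k (P : nat -> set nat) :
  (forall i, ultrafilter_sets U (P i)) ->
  ultrafilter_sets U [set n | forall i, (i <= k)%N -> P i n].
Proof.
move=> UP; elim: k => [|k IH].
  by apply: filterS (UP 0%N) => n Pn i; rewrite leqn0 => /eqP ->.
apply: filterS2 IH (UP k.+1) => n IHn Pn i.
by rewrite leq_eqVlt => /predU1P[->//|]; exact: IHn.
Qed.

End UltrafilterLimits.

Section BoundedSequences.
Variables (R : realType) (E : nat -> normedModType R).

Record bounded_seq := BoundedSeq {
  bseq_val :> forall n, E n ;
  bseqP : exists M : R, forall n, `|bseq_val n| <= M
}.

HB.instance Definition _ := gen_eqMixin bounded_seq.
HB.instance Definition _ := gen_choiceMixin bounded_seq.

Lemma bseq_ext (x y : bounded_seq) : (forall n, x n = y n) -> x = y.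
Proof.
case: x y => [x xP] [y yP]/= xy.
have {}xy : x = y by apply: functional_extensionality_dep.
by subst y; congr BoundedSeq; exact: Prop_irrelevance.
Qed.

Lemma bseq0P : exists M : R, forall n, `|0 : E n| <= M.
Proof. by exists 0 => n; rewrite normr0. Qed.

Lemma bseqNP (x : bounded_seq) : exists M : R, forall n, `|- x n| <= M.
Proof. by have [M xM] := bseqP x; exists M => n; rewrite normrN. Qed.

Lemma bseqDP (x y : bounded_seq) : exists M : R, forall n, `|x n + y n| <= M.
Proof.
have [M xM] := bseqP x; have [N yN] := bseqP y; exists (M + N) => n.
by rewrite (le_trans (ler_normD _ _))// lerD.
Qed.

Lemma bseqZP (a : R) (x : bounded_seq) :
  exists M : R, forall n, `|a *: x n| <= M.
Proof.
have [M xM] := bseqP x; exists (`|a| * M) => n; rewrite normrZ.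
exact: ler_wpM2l (normr_ge0 a) _ _ (xM n).
Qed.

Definition bseq0 := BoundedSeq bseq0P.
Definition bseqN x := BoundedSeq (bseqNP x).
Definition bseqD x y := BoundedSeq (bseqDP x y).
Definition bseqZ a x := BoundedSeq (bseqZP a x).

Fact bseq_addA : associative bseqD.
Proof. by move=> x y z; apply: bseq_ext => n /=; rewrite addrA. Qed.
Fact bseq_addC : commutative bseqD.
Proof. by move=> x y; apply: bseq_ext => n /=; rewrite addrC. Qed.
Fact bseq_add0 : left_id bseq0 bseqD.
Proof. by move=> x; apply: bseq_ext => n /=; rewrite add0r. Qed.
Fact bseq_addN : left_inverse bseq0 bseqN bseqD.
Proof. by move=> x; apply: bseq_ext => n /=; rewrite addNr. Qed.

HB.instance Definition _ := GRing.isZmodule.Build bounded_seq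
  bseq_addA bseq_addC bseq_add0 bseq_addN.

Fact bseq_scaleA a b x : bseqZ a (bseqZ b x) = bseqZ (a * b) x.
Proof. by apply: bseq_ext => n /=; rewrite scalerA. Qed.
Fact bseq_scale1 : left_id 1 bseqZ.
Proof. by move=> x; apply: bseq_ext => n /=; rewrite scale1r. Qed.
Fact bseq_scaleDr : right_distributive bseqZ +%R.
Proof. by move=> a x y; apply: bseq_ext => n /=; rewrite scalerDr. Qed.
Fact bseq_scaleDl x : {morph bseqZ^~ x : a b / a + b}.
Proof. by move=> a b; apply: bseq_ext => n /=; rewrite scalerDl. Qed.

HB.instance Definition _ := GRing.Zmodule_isLmodule.Build R bounded_seq
  bseq_scaleA bseq_scale1 bseq_scaleDr bseq_scaleDl.

Lemma bseqDE (x y : bounded_seq) n : (x + y) n = x n + y n.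
Proof. by []. Qed.
Lemma bseqNE (x : bounded_seq) n : (- x) n = - x n.
Proof. by []. Qed.
Lemma bseqBE (x y : bounded_seq) n : (x - y) n = x n - y n.
Proof. by []. Qed.
Lemma bseqZE a (x : bounded_seq) n : (a *: x) n = a *: x n.
Proof. by []. Qed.

End BoundedSequences.

Section Ultraproduct.
Variables (R : realType) (U : nonprincipal_ultrafilter).
Variable E : nat -> normedModType R.
Local Notation bseq := (bounded_seq E).

Definition ultranorm (x : bseq) : R :=
  lim ((fun n => `|x n|) @ ultrafilter_sets U).

Lemma ultranorm_cvg (x : bseq) :
  (fun n => `|x n|) @ ultrafilter_sets U --> ultranorm x.
Proof.
have [M xM] := bseqP x.
by apply: (@ultralim_cvg _ _ _ M) => n; rewrite normr_id.
Qed.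
Arguments ultranorm_cvg : clear implicits.

Lemma ultranorm_ge0 x : 0 <= ultranorm x.
Proof. by apply: (cvgr_to_ge (ultranorm_cvg x)); exact: filterE. Qed.

Lemma ultranormD x y : ultranorm (x + y) <= ultranorm x + ultranorm y.
Proof.
apply: (ler_cvg_to (ultranorm_cvg _)
  (cvgD (ultranorm_cvg x) (ultranorm_cvg y))).
by apply: filterE => n; exact: ler_normD.
Qed.

Lemma ultranormZ a x : ultranorm (a *: x) = `|a| * ultranorm x.
Proof.
rewrite /ultranorm (_ : (fun n => `|_|) = fun n => `|a| * `|x n|).
  by apply: cvg_lim => //; exact: cvgM (cvg_cst _) (ultranorm_cvg x).
by apply/funext => n; rewrite bseqZE normrZ.
Qed.

Lemma ultranormN x : ultranorm (- x) = ultranorm x.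
Proof. by rewrite -scaleN1r ultranormZ normrN1 mul1r. Qed.

Lemma ultranorm0 : ultranorm 0 = 0.
Proof. by rewrite -(scale0r 0) ultranormZ normr0 mul0r. Qed.

Definition null_seq : {pred bseq} := fun x => ultranorm x == 0.

Fact null_seq_zmod_closed : zmod_closed null_seq.
Proof.
split=> [|x y]; first by rewrite unfold_in /null_seq ultranorm0.
rewrite !unfold_in /null_seq => /eqP x0 /eqP y0; rewrite eq_le ultranorm_ge0.
by rewrite andbT (le_trans (ultranormD _ _))// ultranormN x0 y0 addr0.
Qed.

HB.instance Definition _ := GRing.isZmodClosed.Build bseq null_seq
  null_seq_zmod_closed.

Definition ultraproduct := Quotient.quot null_seq.

HB.instance Definition _ := GRing.Zmodule.on ultraproduct.

Definition ultraclass (x : bseq) : ultraproduct :=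
  \pi_(Quotient.quot null_seq)%qT x.

Lemma ultraclass_surj (q : ultraproduct) : exists x, ultraclass x = q.
Proof. by exists (repr q); exact: reprK. Qed.

Lemma ultraclassP x y : ultraclass x = ultraclass y <-> ultranorm (x - y) = 0.
Proof.
by split=> [/eqmodP|/eqP] xy; [|apply/eqmodP]; first exact/eqP.
Qed.

Lemma ultraclassD x y : ultraclass (x + y) = ultraclass x + ultraclass y.
Proof. exact: Quotient.pi_add. Qed.

Lemma ultraclassN x : ultraclass (- x) = - ultraclass x.
Proof. exact: Quotient.pi_opp. Qed.

Definition ultra_scale (a : R) (q : ultraproduct) := ultraclass (a *: repr q).

Definition ultra_norm (q : ultraproduct) : R := ultranorm (repr q).

Lemma ultranorm_repr x : ultranorm (repr (ultraclass x) - x) = 0.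
Proof. by apply/ultraclassP; exact: reprK. Qed.

Lemma ultra_scaleE a x : ultra_scale a (ultraclass x) = ultraclass (a *: x).
Proof.
by apply/ultraclassP; rewrite -scalerBr ultranormZ ultranorm_repr mulr0.
Qed.

Lemma ultra_normE x : ultra_norm (ultraclass x) = ultranorm x.
Proof.
apply/eqP; rewrite eq_le; apply/andP; split.
  rewrite /ultra_norm -[leLHS](congr1 _ (subrK x _)).
  by rewrite (le_trans (ultranormD _ _))// ultranorm_repr add0r.
rewrite -[leRHS]addr0 -{1}(subrK (repr (ultraclass x)) x) addrC.
by rewrite (le_trans (ultranormD _ _))// -opprB ultranormN ultranorm_repr addr0.
Qed.

Fact ultra_scaleA a b q :
  ultra_scale a (ultra_scale b q) = ultra_scale (a * b) q.
Proof.
by have [x <-] := ultraclass_surj q; rewrite !ultra_scaleE scalerA.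
Qed.
Fact ultra_scale1 : left_id 1 ultra_scale.
Proof.
by move=> q; have [x <-] := ultraclass_surj q; rewrite ultra_scaleE scale1r.
Qed.
Fact ultra_scaleDr : right_distributive ultra_scale +%R.
Proof.
move=> a p q; have [x <-] := ultraclass_surj p.
have [y <-] := ultraclass_surj q.
by rewrite -ultraclassD !ultra_scaleE -ultraclassD scalerDr.
Qed.
Fact ultra_scaleDl q : {morph ultra_scale^~ q : a b / a + b}.
Proof.
move=> a b; have [x <-] := ultraclass_surj q.
by rewrite !ultra_scaleE -ultraclassD scalerDl.
Qed.

HB.instance Definition _ := GRing.Zmodule_isLmodule.Build R ultraproduct
  ultra_scaleA ultra_scale1 ultra_scaleDr ultra_scaleDl.

Lemma ultraclassZ a x : ultraclass (a *: x) = a *: ultraclass x.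
Proof. by rewrite -ultra_scaleE. Qed.

Fact ultra_normD p q : ultra_norm (p + q) <= ultra_norm p + ultra_norm q.
Proof.
have [x <-] := ultraclass_surj p; have [y <-] := ultraclass_surj q.
by rewrite -ultraclassD !ultra_normE ultranormD.
Qed.
Fact ultra_normZ a q : ultra_norm (a *: q) = `|a| * ultra_norm q.
Proof.
have [x <-] := ultraclass_surj q.
by rewrite -ultraclassZ !ultra_normE ultranormZ.
Qed.
Fact ultra_norm0_eq0 q : ultra_norm q = 0 -> q = 0.
Proof.
have [x <-] := ultraclass_surj q; rewrite ultra_normE => x0.
rewrite -[RHS](subrr (ultraclass 0)) -ultraclassN -ultraclassD subrr.
by apply/ultraclassP; rewrite subr0.
Qed.

HB.instance Definition _ := Lmodule_isNormed.Build R ultraproduct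
  ultra_normD ultra_normZ ultra_norm0_eq0.

Lemma ultraclass_norm x : `|ultraclass x| = ultranorm x.
Proof. exact: ultra_normE. Qed.

Lemma ultraclass_dist x y : `|ultraclass x - ultraclass y| = ultranorm (x - y).
Proof. by rewrite -ultraclassN -ultraclassD ultraclass_norm. Qed.

(* A Cauchy sequence of classes has a limit obtained by a diagonal choice of
   representatives; this uses non-principality of [U] but not completeness of
   the factors. *)
Lemma ultra_diagonal (f : nat -> bseq) :
  (forall i j, ultranorm (f i - f j) < i.+1%:R^-1 + j.+1%:R^-1) ->
  exists g : bseq, forall k, ultranorm (g - f k) <= k.+1%:R^-1 + k.+1%:R^-1.
Proof.
move=> fcauchy.
pose A k := [set n | forall i j, (i <= k)%N -> (j <= k)%N ->
  `|f i n - f j n| <= i.+1%:R^-1 + j.+1%:R^-1].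
have UA k : ultrafilter_sets U (A k).
  have Uij i j : ultrafilter_sets U
      [set n | `|f i n - f j n| <= i.+1%:R^-1 + j.+1%:R^-1].
    have := ultranorm_cvg (f i - f j).
    move=> /(cvgr_lt _) /(_ _ (fcauchy i j)).
    by apply: filterS => n /ltW.
  apply: filterS (ultrafilter_forall_leq k (fun i =>
    ultrafilter_forall_leq k (Uij i))) => n An i j ik jk; exact: An.
have ex n : exists k, (k <= n)%N && ((k == 0%N) || `[< A k n >]).
  by exists 0%N.
have bd n k : (k <= n)%N && ((k == 0%N) || `[< A k n >]) -> (k <= n)%N.
  by case/andP.
pose k n := ex_maxn (ex n) (@bd n).
have kA n : A (k n) n.
  rewrite /k; case: ex_maxnP => m /andP[_ /orP[/eqP->|/asboolP//]] _ i j.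
  by rewrite !leqn0 => /eqP-> /eqP->; rewrite subrr normr0.
have kmax n m : (m <= n)%N -> A m n -> (m <= k n)%N.
  move=> mn Amn; rewrite /k; case: ex_maxnP => p _; apply.
  by rewrite mn asboolT// orbT.
pose g n := f (k n) n.
have gM : exists M, forall n, `|g n| <= M.
  have [M fM] := bseqP (f 0%N); exists (2 + M) => n.
  rewrite -(subrK (f 0%N n) (g n)) (le_trans (ler_normD _ _))// lerD//.
  rewrite (le_trans (kA n _ _ (leqnn _) (leq0n _)))//.
  rewrite invr1 -[leRHS]/(1 + 1) lerD2r invf_le1// ler1n//.
exists (BoundedSeq gM) => m.
apply: (cvgr_to_le (ultranorm_cvg _)).
apply: filterS2 (UA m) (ultrafilter_ge U m) => n Amn mn.
rewrite bseqBE /= (le_trans (kA n _ _ (leqnn _) (kmax _ _ mn Amn)))//.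
by rewrite lerD2r lef_pV2 ?posrE// ler_nat ltnS kmax.
Qed.

Fact ultraproduct_complete (F : set_system ultraproduct) :
  ProperFilter F -> cauchy F -> cvg F.
Proof.
move=> FF /cauchyP Fc.
have /choice[q Fq] k : exists q : ultraproduct, F (ball q k.+1%:R^-1).
  by apply: Fc; rewrite invr_gt0.
have [|g gq] := @ultra_diagonal (fun k => repr (q k)).
  move=> i j; have /filter_ex[p []] :
      F (ball (q i) i.+1%:R^-1 `&` ball (q j) j.+1%:R^-1).
    exact: filterI.
  rewrite -ball_normE /= => qip qjp.
  rewrite -ultraclass_dist /ultraclass !reprK -(subrKA p).
  by rewrite (le_lt_trans (ler_normD _ _))// ltrD// distrC.
apply/cvg_ex; exists (ultraclass g); apply/cvg_ballP => e e0.
have e30 : 0 < e / 3 by rewrite divr_gt0.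
near \oo => k.
apply: filterS (Fq k) => p; rewrite -!ball_normE /= => qp.
rewrite -(subrKA (q k)) (le_lt_trans (ler_normD _ _))//.
have : `|ultraclass g - q k| <= k.+1%:R^-1 + k.+1%:R^-1.
  by rewrite -{1}[q k]reprK ultraclass_dist.
have : k.+1%:R^-1 < e / 3.
  by near: k; exact: near_infty_natSinv_lt (PosNum e30).
move: qp; move: (k.+1%:R^-1) => t; lra.
Unshelve. all: by end_near. Qed.

HB.instance Definition _ := Uniform_isComplete.Build ultraproduct
  ultraproduct_complete.

End Ultraproduct.

(* The factors of [ultraproduct] need only be normed; the coercion below equips
   the result with the complete structure established above. *)
Definition closed_under_ultraproducts (R : realType)
    (U : nonprincipal_ultrafilter) (C : completeNormedModType R -> Prop) :
    Prop :=
  forall E : nat -> completeNormedModType R, (forall n, C (E n)) ->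
  C (ultraproduct U E : completeNormedModType R).

(* Main.v *)
(* Write [pi] for the linear part of an affine isometric action [rho] on a
   uniformly convex space [X], and, for a set [S] of roots, [Fix S] for the
   points fixed by all [K_a], [a] in [S]. No ultraproduct is needed: everything
   happens in [X], with estimates that are invariant under rescaling.

   Regularity puts every root [a] in the core of some Borel set, so strong
   grading makes [A_a], the union of the [K_c] with [c] off the line of [a],
   generate the group. The relative fixed point property, applied to all actions
   with linear part [pi], then gives through a uniform boundedness argument a
   constant [C] such that a vector moved by at most [s] by [A_a] is moved by at
   most [C s] by [K_a].

   Let [f] be a functional whose zeros among the roots lie on one line, let [N+]
   and [N-] be the roots where it is positive and negative, and let [(x, y)] in
   [Fix N+ * Fix N-] be nearly at minimal distance. For [k] in [K_b] with
   [f b = 0] the pair [(k x, k y)] is in the same set, so by uniform convexity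
   [k x - x] is close to [k y - y]; the first is invariant under [N+], the second
   under [N-], hence [k x - x] is almost fixed by [K_b]. Since the [K_b]-orbit
   of [x] is bounded, [k x - x] is small. So nearly minimal pairs for a chamber
   and its opposite are close to nearly minimal pairs for the adjacent chamber
   and its opposite. Following a line of functionals from a chamber to its
   opposite shows that a nearly minimal pair consists of two points that are
   close to each other, which is absurd at the scale of their distance. Hence
   the distance can be contracted geometrically, and the limit is a point fixed
   by a Borel set and its opposite, that is, by the whole group. *)
Require Import Defs.
From mathcomp Require Import all_boot all_order all_algebra.
From mathcomp Require Import finmap.
From mathcomp Require Import all_classical all_reals all_analysis.
From mathcomp Require Import lra ring.
Import Order.TTheory GRing.Theory Num.Theory.
Import numFieldNormedType.Exports.
Local Open Scope classical_set_scope.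
Local Open Scope ring_scope.

(** * Uniform convexity on balls and relative Chebyshev centers *)

Section UniformConvexity.
Set Implicit Arguments.
Unset Strict Implicit.
Variables (R : realType) (X : completeNormedModType R).
Hypothesis uc : uniformly_convex X.

Lemma normr_half (x : X) : `|2^-1 *: x| = `|x| / 2.
Proof. by rewrite normrZ ger0_norm ?invr_ge0// mulrC. Qed.

Lemma normr_normalize (x : X) : x != 0 -> `| `|x|^-1 *: x| = 1.
Proof. by move=> x0; rewrite normrZ normfV normr_id mulVf// normr_eq0. Qed.

Lemma normr_sub_normalize (x : X) : x != 0 -> `|x| <= 1 ->
  `|x - `|x|^-1 *: x| = 1 - `|x|.
Proof.
move=> x0 x1; have nx0 : 0 < `|x| by rewrite normr_gt0.
rewrite -{1}[x]scale1r -scalerBl normrZ ler0_norm; last first.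
  by rewrite subr_le0 invf_ge1.
by rewrite opprB mulrBl mulVf ?gt_eqF// mul1r.
Qed.

(** A vector of norm below [1 - t] already shortens the midpoint by [t / 2]. Otherwise normalizing
    moves each vector by at most [t <= e / 4], so the unit vectors stay [e / 2] apart, and
    [t <= delta (e / 2) / 2] absorbs the error made at the midpoint. *)
Lemma uniformly_convex_unit_ball (e : R) : 0 < e -> exists2 d : R, 0 < d &
  forall a b : X, `|a| <= 1 -> `|b| <= 1 -> e <= `|a - b| ->
    `|2^-1 *: (a + b)| <= 1 - d.
Proof.
move=> e0; have [delta ucX] := uc.
have [e2|e2] := leP e 2; last first.
  exists 1 => // a b a1 b1 /le_trans/(_ (ler_normB _ _)) eab; exfalso; lra.
have [|/andP[dgt0 dle1] ucXe] := ucX (e / 2); first by apply/andP; split; lra.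
pose t := Num.min (e / 4) (delta (e / 2) / 2).
have te : t <= e / 4 by rewrite ge_min lexx.
have td : t <= delta (e / 2) / 2 by rewrite ge_min lexx orbT.
have t0 : 0 < t by rewrite lt_min; apply/andP; split; lra.
exists (t / 2); first lra.
move=> a b a1 b1 eab; rewrite normr_half.
have nD := ler_normD a b.
have [at1|at1] := ltP `|a| (1 - t); first lra.
have [bt1|bt1] := ltP `|b| (1 - t); first lra.
have a0 : a != 0 by rewrite -normr_gt0; lra.
have b0 : b != 0 by rewrite -normr_gt0; lra.
have := ucXe _ _ (normr_normalize a0) (normr_normalize b0).
have := normr_sub_normalize a0 a1; have := normr_sub_normalize b0 b1.
set a' := _ *: a; set b' := _ *: b.
have ab1 := ler_distD a' a b; have ab2 := ler_distD b' a' b.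
have abm := ler_normD (2^-1 *: (a' + b')) (2^-1 *: ((a - a') + (b - b'))).
rewrite -scalerDr addrACA (addrC a') (addrC b') !subrK !normr_half in abm.
have aabb := ler_normD (a - a') (b - b').
rewrite (distrC b') in ab2.
rewrite normr_half => bb' aa' /(_ _)/wrap[|]; lra.
Qed.

Lemma uniformly_convex_ball (e : R) : 0 < e -> exists2 d : R, 0 < d &
  forall (r : R) (a b : X), 0 < r -> `|a| <= r -> `|b| <= r ->
    e * r <= `|a - b| -> `|2^-1 *: (a + b)| <= (1 - d) * r.
Proof.
move=> /uniformly_convex_unit_ball[d d0 ucd]; exists d => // r a b r0 ar br eab.
have nV (x : X) : `|r^-1 *: x| = `|x| / r.
  by rewrite normrZ ger0_norm 1?mulrC// invr_ge0 ltW.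
rewrite -ler_pdivrMr// -nV scalerA mulrC -scalerA scalerDr.
by apply: ucd; rewrite -?scalerBr nV ?ler_pdivrMr ?ler_pdivlMr// mul1r.
Qed.

Lemma cauchy_seq_limit (u : nat -> X) :
  (forall e : R, 0 < e ->
     exists N, forall n m, (N <= n)%N -> (N <= m)%N -> `|u n - u m| < e) ->
  exists l, forall e : R, 0 < e ->
    exists N, forall n, (N <= n)%N -> `|u n - l| < e.
Proof.
move=> cu; have : cvg (u @ \oo).
  apply: cauchy_cvg; apply: cauchy_exP => e e0.
  have [N uN] := cu _ e0; exists (u N); exists N => // n /= Nn.
  by rewrite -ball_normE/=; exact: uN.
move=> /cvg_ex[l /cvgrPdist_lt ul]; exists l => e /ul[N _ uN].
by exists N => n Nn; rewrite distrC; exact: uN.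
Qed.

Definition limit_closed (F : set X) : Prop :=
  forall l, (forall e : R, 0 < e -> exists2 z, F z & `|z - l| < e) -> F l.

(** If two nearly optimal centers in [F] were far apart, uniform convexity would make their midpoint
    better than the infimal radius [r]. So a minimizing sequence is Cauchy and the center is unique;
    uniqueness later makes it invariant under symmetries of [O]. *)
Lemma chebyshev_center (O F : set X) (x : X) (s : R) :
  limit_closed F -> (forall a b, F a -> F b -> F (2^-1 *: (a + b))) ->
  F x -> O !=set0 -> (forall y, O y -> `|y - x| <= s) ->
  exists c r, [/\ F c, r <= s, forall y, O y -> `|y - c| <= r &
    forall c', F c' -> (forall y, O y -> `|y - c'| <= r) -> c' = c].
Proof.
move=> Fcl Fmid Fx [y0 Oy0] Os.
pose S := [set r : R | exists2 z, F z & forall y, O y -> `|y - z| <= r].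
have Ss : S s by exists x.
have Slb : lbound S 0 by move=> r [z _ /(_ _ Oy0)]; apply: le_trans.
have Sinf : has_inf S by split; [exists s|exists 0].
pose r := inf S.
have r0 : 0 <= r by apply: lb_le_inf => //; exists s.
have rS t : S t -> r <= t by apply: ge_inf; exists 0.
have diam e : 0 < e -> exists2 h, 0 < h & forall z z', F z -> F z' ->
    (forall y, O y -> `|y - z| <= r + h) ->
    (forall y, O y -> `|y - z'| <= r + h) -> `|z - z'| < e.
  move=> e0; have [r_eq0|r_neq0] := eqVneq r 0.
    exists (e / 4); first lra.
    move=> z z' _ _ /(_ _ Oy0) yz /(_ _ Oy0) yz'.
    have := ler_distD y0 z z'; rewrite (distrC z y0); lra.
  have rgt0 : 0 < r by rewrite lt_def r_neq0.
  have [|d d0 dP] := @uniformly_convex_ball (e / (2 * r)).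
    by rewrite divr_gt0// mulr_gt0.
  (* [h <= r] keeps [r + h] at most [2 * r], matching the relative separation [e / (2 * r)];
     [h <= d * r / 2] makes [(1 - d) * (r + h) < r]. *)
  pose h := Num.min r (d * r / 2).
  have hr : h <= r by rewrite ge_min lexx.
  have hd : h <= d * r / 2 by rewrite ge_min lexx orbT.
  have h0 : 0 < h by rewrite lt_min rgt0 divr_gt0// mulr_gt0.
  exists h => // z z' Fz Fz' yz yz'; rewrite ltNge; apply/negP => ezz.
  suff : r <= (1 - d) * (r + h) by have := mulr_gt0 d0 h0; have := mulr_gt0 d0 rgt0; lra.
  apply: rS; exists (2^-1 *: (z + z')); first exact: Fmid.
  move=> y Oy.
  have -> : y - 2^-1 *: (z + z') = 2^-1 *: ((y - z) + (y - z')).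
    rewrite addrACA -opprD scalerBr; congr (_ - _).
    by rewrite scalerDr -scalerDl -div1r -splitr scale1r.
  apply: dP; [lra|exact: yz|exact: yz'|].
  rewrite opprB [X in `|X|]addrC subrKA distrC (le_trans _ ezz)//.
  rewrite mulrAC ler_pdivrMr ?mulr_gt0// ler_pM2l//; lra.
have diam0 z z' : F z -> F z' -> (forall y, O y -> `|y - z| <= r) ->
    (forall y, O y -> `|y - z'| <= r) -> z = z'.
  move=> Fz Fz' zr z'r; have [//|zz'] := eqVneq z z'.
  have nzz : 0 < `|z - z'| by rewrite normr_gt0 subr_eq0.
  have [h h0 hP] := diam _ nzz; have : `|z - z'| < `|z - z'|.
    by apply: hP => // y Oy; [have := zr y Oy|have := z'r y Oy]; lra.
  by rewrite ltxx.
have ex n : exists z, F z /\ forall y, O y -> `|y - z| <= r + n.+1%:R^-1.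
  have n0 : (0 : R) < n.+1%:R^-1 by rewrite invr_gt0.
  have [t [z Fz zt] tr] := inf_adherent n0 Sinf.
  by exists z; split=> // y /zt/le_trans; apply; exact: ltW.
have [u uP] := choice ex.
have [|c cP] := @cauchy_seq_limit u.
  move=> e /diam[h h0 hP].
  have [N _ /(_ _ (leqnn _)) NP] := near_infty_natSinv_lt (PosNum h0).
  have uN n : (N <= n)%N -> forall y, O y -> `|y - u n| <= r + h.
    move=> Nn y /(uP n).2/le_trans; apply; rewrite lerD2l (le_trans _ (ltW NP))//.
    by rewrite lef_pV2 ?posrE// ler_nat.
  exists N => n m Nn Nm.
  by apply: hP; [exact: (uP _).1|exact: (uP _).1|exact: uN|exact: uN].
have Fc : F c.
  by apply: Fcl => e /cP[N NP]; exists (u N); [exact: (uP _).1|exact: NP].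
have cr y : O y -> `|y - c| <= r.
  move=> Oy; apply/ler_addgt0Pl => e e0.
  have e20 : 0 < e / 2 by lra.
  have [N _ NP] := near_infty_natSinv_lt (PosNum e20).
  have [M MP] := cP _ e20; pose n := maxn N M.
  have := MP n (leq_maxr _ _); have := NP n (leq_maxl _ _) => /=.
  have := (uP n).2 _ Oy; have := ler_distD (u n) y c.
  clearbody n; move: (n.+1%:R^-1) => t; lra.
exists c, r; split => //; first exact: rS.
by move=> c' Fc' c'r; exact: diam0.
Qed.

End UniformConvexity.

(** * Linear parts of affine isometric actions, and displacement *)

Section LinearPart.
Set Implicit Arguments.
Unset Strict Implicit.
Variables (R : realType) (G : groupType) (X : completeNormedModType R).

Definition linear_part (rho : G -> X -> X) (g : G) (v : X) : X :=
  rho g v - rho g 0.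

Variable rho : G -> X -> X.
Hypothesis rhoA : affine_isometric_action rho.
Local Notation pi := (linear_part rho).

Lemma action1 x : rho 1%g x = x.
Proof. by have [-> _ _] := rhoA. Qed.

Lemma actionM g h x : rho (g * h)%g x = rho g (rho h x).
Proof. by have [_ -> _] := rhoA. Qed.

Lemma actionV g x : rho g^-1%g (rho g x) = x.
Proof. by rewrite -actionM mulVg action1. Qed.

Lemma action_dist g x y : `|rho g x - rho g y| = `|x - y|.
Proof. by have [_ _ /(_ g)[_ ->]] := rhoA. Qed.

Lemma linear_partE g : exists L : {linear X -> X}, pi g =1 L.
Proof.
have [_ _ /(_ g)[[L [b LE]] _]] := rhoA; exists L => v.
by rewrite /linear_part !LE linear0 add0r addrK.
Qed.

Lemma linear_partD g : {morph pi g : x y / x + y}.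
Proof. by have [L LE] := linear_partE g => x y; rewrite !LE linearD. Qed.

Lemma linear_partB g : {morph pi g : x y / x - y}.
Proof. by have [L LE] := linear_partE g => x y; rewrite !LE linearB. Qed.

Lemma linear_partZ g a : {morph pi g : x / a *: x}.
Proof. by have [L LE] := linear_partE g => x; rewrite !LE linearZ. Qed.

Lemma linear_part_sub g x y : pi g (x - y) = rho g x - rho g y.
Proof. by rewrite linear_partB /linear_part opprB addrA subrK. Qed.

Lemma norm_linear_part g v : `|pi g v| = `|v|.
Proof. by rewrite /linear_part action_dist subr0. Qed.

Lemma linear_part1 v : pi 1%g v = v.
Proof. by rewrite /linear_part !action1 subr0. Qed.

Lemma linear_partM g h v : pi (g * h)%g v = pi g (pi h v).
Proof. by rewrite {3}/linear_part linear_part_sub /linear_part !actionM. Qed.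

Lemma action_midpoint g x y :
  rho g (2^-1 *: (x + y)) = 2^-1 *: (rho g x + rho g y).
Proof.
have [_ _ /(_ g)[[L [b LE]] _]] := rhoA; rewrite !LE linearZ linearD addrACA.
by rewrite scalerDr [X in _ = _ + X]scalerDr -scalerDl -div1r -splitr scale1r.
Qed.

Definition displacement (g : G) (w : X) : R := `|pi g w - w|.

Lemma displacementD g v w :
  displacement g (v + w) <= displacement g v + displacement g w.
Proof. by rewrite /displacement linear_partD opprD addrACA ler_normD. Qed.

Lemma displacementZ g a w : displacement g (a *: w) = `|a| * displacement g w.
Proof. by rewrite /displacement linear_partZ -scalerBr normrZ. Qed.

Lemma displacementV g w : displacement g^-1%g w = displacement g w.
Proof.
rewrite {1}/displacement -(norm_linear_part g) linear_partB -linear_partM mulgV.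
by rewrite linear_part1 distrC.
Qed.

Lemma displacementM g h w :
  displacement (g * h)%g w <= displacement g w + displacement h w.
Proof.
rewrite /displacement linear_partM (le_trans (ler_distD (pi g w) _ _))//.
by rewrite addrC lerD2l -linear_partB norm_linear_part.
Qed.

(** The [g] admitting such an [M] form a subgroup containing [A], since [displacement] is
    subadditive on products and invariant under inversion. [M] acts as a word length of [g],
    independent of [w]. *)
Lemma displacement_generated (A : set G) (g : G) :
  generated_subgroup A g -> exists M, 0 <= M /\
  forall w s, 0 <= s -> (forall a, A a -> displacement a w <= s) ->
    displacement g w <= M * s.
Proof.
move=> /(_ [set g | exists M, 0 <= M /\ forall w s, 0 <= s ->
  (forall a, A a -> displacement a w <= s) -> displacement g w <= M * s]).
apply; split => /=; last first.
  by move=> a Aa; exists 1; split=> // w s _; rewrite mul1r; exact.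
split.
  by exists 0; split=> // w s *; rewrite mul0r /displacement linear_part1 subrr normr0.
move=> x y [M [M0 xM]] [N [N0 yN]]; exists (M + N); split; first exact: addr_ge0.
move=> w s s0 As; rewrite mulrDl (le_trans (displacementM _ _ _))//.
by rewrite displacementV lerD ?xM ?yN.
Qed.

End LinearPart.

(** * Uniform displacement bounds from the relative fixed point property *)

Section UniformDisplacement.
Set Implicit Arguments.
Unset Strict Implicit.
Variables (R : realType) (G : groupType) (X : completeNormedModType R).

Lemma geometric_lt (q c e : R) : 0 <= q <= 2^-1 -> 0 < e ->
  exists N, c * q ^+ N < e.
Proof.
move=> /andP[q0 q2] e0; have c0 : 0 < `|c| + 1 by rewrite ltr_wpDl.
have [N _ /(_ N (leqnn _)) /= NP] := near_infty_natSinv_lt (PosNum (divr_gt0 e0 c0)).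
exists N; rewrite (le_lt_trans (ler_norm _))// normrM (ger0_norm (exprn_ge0 _ q0)).
rewrite ltr_pdivlMr// mulrC in NP; apply: le_lt_trans NP.
apply: ler_pM => //; first exact: exprn_ge0.
  by rewrite lerDl.
rewrite (le_trans (lerXn2r N _ _ q2))// ?nnegrE// ?invr_ge0//.
by rewrite exprVn lef_pV2 ?posrE ?exprn_gt0// -natrX ler_nat ltn_expl.
Qed.

Variable rho : G -> X -> X.
Hypothesis rhoA : affine_isometric_action rho.
Local Notation pi := (linear_part rho).
Local Notation D := (displacement rho).

Section Limit.
Variables (A : set G) (u : nat -> X).
Hypothesis genA : forall g, generated_subgroup A g.
Hypothesis u_step : forall n a, A a -> D a (u n.+1 - u n) <= 3^-1 ^+ n.

Lemma displacement_tail m n a : A a -> (m <= n)%N ->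
  D a (u n - u m) <= 3^-1 ^+ m * (3 / 2).
Proof.
move=> Aa /subnKC<-; move: (n - m)%N => k {n}; elim: k m => [|k IH] m.
  by rewrite addn0 subrr -(scale0r 0) displacementZ// normr0 mul0r mulr_ge0// exprn_ge0.
rewrite -addSnnS -(subrK (u m.+1) (u _)) -addrA.
have := displacementD rhoA a (u (m.+1 + k)%N - u m.+1) (u m.+1 - u m).
have := IH m.+1; have := u_step m Aa; rewrite exprS; lra.
Qed.

(** The sequence [u] itself need not converge, but its coboundaries do at each [g], because the
    bounds on [A] pass to [g] with a constant depending on [g]. The limit is a cocycle, hence
    defines an action with the same linear part. *)
Lemma limit_cocycle : exists b : G -> X,
  [/\ forall g e, 0 < e -> exists N, forall n, (N <= n)%N ->
        `|(pi g (u n) - u n) - b g| < e &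
      affine_isometric_action (fun g x => pi g x + b g)].
Proof.
have lim g : exists l, forall e : R, 0 < e -> exists N, forall n, (N <= n)%N ->
    `|(pi g (u n) - u n) - l| < e.
  apply: cauchy_seq_limit => e e0.
  have [M [M0 gM]] := displacement_generated rhoA (genA g).
  have tail m n : (m <= n)%N -> D g (u n - u m) <= M * (3^-1 ^+ m * (3 / 2)).
    move=> mn; apply: gM => [|a Aa]; last exact: displacement_tail.
    by rewrite mulr_ge0// exprn_ge0.
  have [N NP] : exists N, (M * (3 / 2)) * 3^-1 ^+ N < e / 2.
    by apply: geometric_lt; lra.
  have Ntail n : (N <= n)%N -> `|(pi g (u n) - u n) - (pi g (u N) - u N)| < e / 2.
    move=> Nn; rewrite (le_lt_trans _ NP)// -mulrA (mulrC _ (3^-1 ^+ N)) (le_trans _ (tail _ _ Nn))//.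
    by rewrite /displacement linear_partB// !opprD addrACA -!opprD opprD opprK.
  exists N => n m /Ntail un /Ntail um.
  have := ler_distD (pi g (u N) - u N) (pi g (u n) - u n) (pi g (u m) - u m).
  by rewrite (distrC (pi g (u N) - u N)); lra.
have [b bP] := choice lim; exists b; split=> //.
have bM g h : b (g * h)%g = pi g (b h) + b g.
  apply/eqP; rewrite -subr_eq0 -normr_eq0; apply/eqP/le_anti/andP; split => //.
  apply/ler_addgt0Pl => e e0; rewrite addr0.
  have e3 : 0 < e / 3 by lra.
  have [N1 P1] := bP (g * h)%g _ e3; have [N2 P2] := bP h _ e3.
  have [N3 P3] := bP g _ e3.
  pose n := maxn N1 (maxn N2 N3).
  have /P1 : (N1 <= n)%N by rewrite leq_maxl.
  have /P2 : (N2 <= n)%N by rewrite /n maxnCA leq_maxl.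
  have /P3 : (N3 <= n)%N by rewrite /n maxnA leq_maxr.
  have -> : pi (g * h)%g (u n) - u n = pi g (pi h (u n) - u n) + (pi g (u n) - u n).
    by rewrite linear_partB// linear_partM// subrKA.
  set w := pi h _ - _; set v := pi g (u n) - u n => vb wb vwb.
  have {}wb : `|pi g w - pi g (b h)| < e / 3 by rewrite -linear_partB// norm_linear_part.
  have := ler_distD (pi g w + v) (b (g * h)%g) (pi g (b h) + b g).
  have := ler_normD (pi g w - pi g (b h)) (v - b g).
  rewrite (addrACA (pi g w)) -opprD (distrC (b (g * h)%g) (pi g w + v)); lra.
have b1 : b 1%g = 0.
  have := bM 1%g 1%g; rewrite mulg1 linear_part1// => /eqP.
  by rewrite -subr_eq0 opprD addrA subrr sub0r oppr_eq0 => /eqP.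
split=> [x|g h x|g].
- by rewrite linear_part1// b1 addr0.
- by rewrite linear_partM// linear_partD// bM addrA.
split; last by move=> x y; rewrite opprD addrACA subrr addr0 -linear_partB// norm_linear_part.
by have [L LE] := linear_partE rhoA g; exists L, (b g) => x; rewrite LE.
Qed.
End Limit.

Section Bound.
Variables A K : set G.
Hypothesis genA : forall g, generated_subgroup A g.
Hypothesis relF : forall rho' : G -> X -> X, affine_isometric_action rho' ->
  exists x, forall k, K k -> rho' k x = x.

Definition displacement_bound (g : G) (T : R) : Prop :=
  forall w s, 0 <= s -> (forall a, A a -> D a w <= s) -> D g w <= T * s.

(** [T] is the best constant for [g]: the supremum of its displacement over the vectors that [A]
    moves by at most 1. It is finite because [A] generates, and a slack of [T / 4] yields the
    near-maximizer [v]. *)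
Lemma displacement_bound_attained g c w s : 0 <= c -> 0 <= s ->
  (forall a, A a -> D a w <= s) -> c * s < D g w ->
  exists v T, [/\ forall a, A a -> D a v <= 1, c < T, 3 / 4 * T <= D g v &
    displacement_bound g T].
Proof.
move=> c0 s0 ws cw; have [M [M0 gM]] := displacement_generated rhoA (genA g).
have sgt0 : 0 < s.
  rewrite lt_def s0 andbT; apply/eqP => s_eq0.
  by have := gM w s s0 ws; rewrite s_eq0 mulr0; move: cw; rewrite s_eq0 mulr0; lra.
pose S := [set D g v | v in [set v | forall a, A a -> D a v <= 1]].
have nVs : `|s^-1| = s^-1 by rewrite ger0_norm// invr_ge0.
have Sw : S (D g w / s).
  exists (s^-1 *: w); last by rewrite displacementZ// nVs mulrC.
  by move=> a Aa; rewrite displacementZ// nVs mulrC ler_pdivrMr// mul1r ws.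
have Sub : ubound S M.
  by move=> _ [v v1 <-]; rewrite -[M]mulr1; apply: gM.
have Ssup : has_sup S by split; [exists (D g w / s)|exists M].
have cT : c < sup S.
  rewrite (@lt_le_trans _ _ (D g w / s)) ?ltr_pdivlMr//.
  by apply: ub_le_sup => //; exists M.
have T0 : 0 < sup S / 4 by rewrite divr_gt0//; lra.
have [_ [v v1 <-] Tv] := sup_adherent T0 Ssup.
exists v, (sup S); split => //; first lra.
move=> w' t t0 w't; have [t_eq0|t_neq0] := eqVneq t 0.
  by have := gM _ _ t0 w't; rewrite t_eq0 !mulr0.
have tgt0 : 0 < t by rewrite lt_def t_neq0.
have nVt : `|t^-1| = t^-1 by rewrite ger0_norm// invr_ge0.
rewrite -ler_pdivrMr//; apply: ub_le_sup; first by exists M.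
exists (t^-1 *: w'); last by rewrite displacementZ// nVt mulrC.
by move=> a Aa; rewrite displacementZ// nVt mulrC ler_pdivrMr// mul1r w't.
Qed.

(** Since [2 b] is the difference of [a + b] and [a - b], one of the two is displaced by [k] at
    least as much as [b]; this sign selects it. *)
Definition hump_sign (k : G) (a b : X) : R :=
  if D k b <= D k (a + b) then 1 else -1.

Lemma norm_hump_sign k a b : `|hump_sign k a b| = 1.
Proof. by rewrite /hump_sign; case: ifP; rewrite ?normrN normr1. Qed.

Lemma hump_signP k a b : D k b <= D k (a + hump_sign k a b *: b).
Proof.
rewrite /hump_sign; case: ifPn => [|]; first by rewrite scale1r.
rewrite -ltNge scaleN1r => abb.
have := displacementD rhoA k (b - a) (a + b); rewrite addrA subrK.
have -> : D k (b + b) = 2 * D k b.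
  by rewrite -mulr2n -scaler_nat displacementZ// ger0_norm.
have -> : D k (b - a) = D k (a - b); last lra.
by rewrite -[b - a]opprB -scaleN1r displacementZ// normrN normr1 mul1r.
Qed.

(* Gliding hump, following Sokal's proof of the uniform boundedness principle:
   if the constants were unbounded, a series of coboundaries would converge
   pointwise on [G] to a cocycle that is unbounded on [K]. *)
Lemma uniform_displacement : exists C, 0 <= C /\
  forall k, K k -> displacement_bound k C.
Proof.
apply: contrapT => noC.
have ex n : exists p : G * X * R, [/\ K p.1.1, forall a, A a -> D a p.1.2 <= 1,
    8 ^+ n < p.2, 3 / 4 * p.2 <= D p.1.1 p.1.2 & displacement_bound p.1.1 p.2].
  apply: contrapT => nex; apply: noC; exists (8 ^+ n); split; first exact: exprn_ge0.
  move=> k Kk w s s0 ws; rewrite leNgt; apply/negP.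
  have c0 : (0 : R) <= 8 ^+ n by exact: exprn_ge0.
  move=> /(displacement_bound_attained c0 s0 ws)[v [T [v1 nT Tv kT]]].
  by apply: nex; exists (k, v, T).
have [p pP] := choice ex.
(* The [m]-th term is [3^-m] times a vector that [A] moves by at most 1 and some element of [K] by
   nearly its best constant, above [8 ^ m]. The sign keeps earlier terms from cancelling the new
   one. *)
pose u := fix u n := if n is m.+1 then u m + hump_sign (p m).1.1 (u m)
  (3^-1 ^+ m *: (p m).1.2) *: (3^-1 ^+ m *: (p m).1.2) else 0.
have n3 n : `|3^-1 ^+ n| = 3^-1 ^+ n :> R by rewrite ger0_norm// exprn_ge0.
have u_step n a : A a -> D a (u n.+1 - u n) <= 3^-1 ^+ n.
  move=> Aa; rewrite /= [X in D a X]addrC addKr displacementZ// norm_hump_sign.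
  rewrite mul1r displacementZ// n3 ler_piMr ?exprn_ge0//.
  by have [_ + _ _ _] := pP n; exact.
have [b [bP rho'A]] := limit_cocycle genA u_step.
have [z zP] := relF rho'A.
have c0 : 0 <= (3 / 8 : R) <= 2^-1 by apply/andP; split; lra.
(* This makes [(8 / 3) ^ n] exceed 4 times [2 |z| + 1]: the fixed point [z] bounds the cocycle on
   [K] by [2 |z|], and the extra 1 pays for replacing the limit by some [u m]. *)
have [n nP] := @geometric_lt _ ((2 * `|z| + 1) * 4) _ c0 ltr01.
have [Kk w1 nT Tw kT] := pP n; set k := (p n).1.1 in Kk kT Tw.
set w := (p n).1.2 in w1 Tw; set T := (p n).2 in nT Tw kT.
have un : 3^-1 ^+ n * (3 / 4 * T) <= D k (u n.+1).
  rewrite (le_trans _ (hump_signP _ _ _))//= displacementZ// n3 ler_wpM2l//.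
(* The later terms change the displacement under [k] by at most [T * 3^-(n+1) * 3 / 2], that is
   [T * 3^-n / 2], because [T] is a bound for [k]; of the factor 3/4 this leaves 1/4. *)
have um m : (n < m)%N -> 3^-1 ^+ n * T / 4 <= D k (u m).
  move=> nm; have := displacementD rhoA k (u m) (u n.+1 - u m).
  rewrite addrC subrK.
  have -> : D k (u n.+1 - u m) = D k (u m - u n.+1).
    by rewrite -[X in D k X]opprB -scaleN1r displacementZ// normrN normr1 mul1r.
  have t0 : (0 : R) <= 3^-1 ^+ n.+1 * (3 / 2) by rewrite mulr_ge0// exprn_ge0.
  have := kT (u m - u n.+1) _ t0 (fun a Aa => displacement_tail u_step Aa nm).
  rewrite exprS; move: un; move: (3^-1 ^+ n) => y; nra.
have [N NP] := bP k _ (ltr01 : 0 < 1 :> R); pose m := maxn N n.+1.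
have := NP m (leq_maxl _ _); have := um m (leq_maxr _ _).
have bz : b k = z - pi k z by rewrite -{1}(zP k Kk) addrC addKr.
have := ler_normB z (pi k z); rewrite norm_linear_part// -bz.
have := ler_normD (pi k (u m) - u m - b k) (b k); rewrite subrK /displacement.
have : 3^-1 ^+ n * 8 ^+ n <= 3^-1 ^+ n * T by rewrite ler_wpM2l ?exprn_ge0// ltW.
have : 3^-1 ^+ n * 8 ^+ n * (3 / 8) ^+ n = 1 :> R.
  by rewrite -!exprMn (_ : _ * _ = 1) ?expr1n//; lra.
have q0 : (0 : R) < (3 / 8) ^+ n by rewrite exprn_gt0//; lra.
move: nP; move: (3^-1 ^+ n * T) (3^-1 ^+ n * 8 ^+ n) ((3 / 8) ^+ n) q0.
move=> x y q q0 cq1 yq1 yx h1 h2 h3 h4.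
have : y <= (2 * `|z| + 1) * 4 by lra.
by move=> /(ler_wpM2r (ltW q0)); rewrite yq1; lra.
Qed.

End Bound.
End UniformDisplacement.

(** * Fixed sets of families of root subgroups *)

Section FixedSets.
Set Implicit Arguments.
Unset Strict Implicit.
Variables (R : realType) (V : vectType R) (G : groupType).
Variables (Phi : {fset V}) (K : V -> set G).
Hypothesis gradedK : graded_by Phi K.
Variable X : completeNormedModType R.
Hypothesis ucX : uniformly_convex X.
Variable rho : G -> X -> X.
Hypothesis rhoA : affine_isometric_action rho.

Lemma functional_comb (g : 'Hom(V, R^o)) s t a b :
  g (s *: a + t *: b) = s * g a + t * g b :> R.
Proof. by rewrite linearD !linearZ. Qed.

Lemma functionalZ (g : 'Hom(V, R^o)) s a : g (s *: a) = s * g a :> R.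
Proof. by rewrite linearZ. Qed.

Lemma fixed_generated (A : set G) x : (forall a, A a -> rho a x = x) ->
  forall g, generated_subgroup A g -> rho g x = x.
Proof.
move=> Ax g /(_ [set g | rho g x = x]); apply; split => //=; split.
  exact: action1.
by move=> h k /= hx kx; rewrite actionM// -{1}kx actionV.
Qed.

(** [H] permutes the orbit of [x], so it fixes the unique Chebyshev center of that orbit relative to
    the stable set [F]. The center is within [r] of [x] because [x] belongs to the orbit. *)
Lemma fixed_point_of_small_orbit (H : set G) (F : set X) (x : X) (r : R) :
  is_subgroup H -> limit_closed F ->
  (forall a b, F a -> F b -> F (2^-1 *: (a + b))) ->
  (forall h y, H h -> F y -> F (rho h y)) ->
  F x -> (forall h, H h -> `|rho h x - x| <= r) ->
  exists c, [/\ F c, `|c - x| <= r & forall h, H h -> rho h c = c].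
Proof.
move=> [H1 HV] Fcl Fmid FH Fx Hx.
have [||c [s [Fc sr Oc cU]]] := chebyshev_center ucX (O := [set rho h x | h in H]) Fcl Fmid Fx _ (s := r).
- by exists (rho 1%g x), 1%g.
- by move=> _ [h Hh <-]; exact: Hx.
exists c; split => //.
  by rewrite (le_trans _ sr)// distrC; apply: Oc; exists 1%g => //; exact: action1.
move=> h Hh; apply: cU; first exact: FH.
move=> _ [k Hk <-]; rewrite -(action_dist rhoA h^-1%g) actionV// -actionM//.
apply: Oc; exists (h^-1 * k)%g => //; rewrite -[k]invgK.
by apply: (HV); rewrite -[X in H X]mul1g; exact: HV.
Qed.

Definition fixed_set (S : set V) : set X :=
  [set x | forall b, S b -> forall k, K b k -> rho k x = x].

Lemma fixed_set_sub (S T : set V) : S `<=` T -> fixed_set T `<=` fixed_set S.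
Proof. by move=> ST x Tx b /ST; exact: Tx. Qed.

Lemma fixed_set_midpoint S a b :
  fixed_set S a -> fixed_set S b -> fixed_set S (2^-1 *: (a + b)).
Proof. by move=> Sa Sb v Sv k Kk; rewrite action_midpoint// (Sa v)// (Sb v). Qed.

Lemma fixed_set_closed S : limit_closed (fixed_set S).
Proof.
move=> l Sl b Sb k Kk; apply/eqP; rewrite -subr_eq0 -normr_eq0.
apply/eqP/le_anti/andP; split => //; apply/ler_addgt0Pl => e e0; rewrite addr0.
have [|z Sz zl] := Sl (e / 2); first lra.
have := ler_distD z (rho k l) l.
by rewrite -{1}(Sz b Sb k Kk) action_dist// (distrC l); lra.
Qed.

(** The commutator of [h] in [K a] and [k] in [K b] lies in the group generated by root subgroups of
    [S], so it fixes [x]; then [h * k = k * h * [h, k]] shows that [h] fixes [rho k x]. *)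
Lemma fixed_set_stable S b : b \in Phi ->
  (forall a, S a -> [/\ a \in Phi, ~ (exists2 c : R, c < 0 & b = c *: a) &
    forall s t : R, 1 <= s -> 1 <= t -> s *: a + t *: b \in Phi ->
      S (s *: a + t *: b)]) ->
  forall k x, K b k -> fixed_set S x -> fixed_set S (rho k x).
Proof.
move=> Phib Sb k x Kk Sx a Sa h Kh; have [Phia nab Sab] := Sb a Sa.
have [_ _ /(_ a b Phia Phib nab) comm] := gradedK.
have hkx : rho [~ h, k]%g x = x.
  have /comm : commutator_subgroup (K a) (K b) [~ h, k]%g.
    by move=> M [_ AM]; apply: AM; exists h, k.
  apply: fixed_generated => g [c [Phic [s [t [s1 t1 ct]]]] Kg].
  by apply: (Sx c) => //; rewrite ct; apply: Sab => //; rewrite -ct.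
by rewrite -actionM// commgC actionM// hkx actionM// (Sx a).
Qed.

(** The roots of [T] are adjoined by decreasing [g], the head [b] last: a sum [s *: a + t *: c] with
    [s, t >= 1] has larger [g] than its terms, so it never brings back a smaller root. Hence the
    fixed set reached so far is stable under [K b], and a Chebyshev center gives the new point. From
    distance [4 ^ n * r], the [K b]-orbit has radius at most [(2 * 4 ^ n + 1) * r], and
    [3 * 4 ^ n + 1 <= 4 ^ n.+1]. *)
Lemma fixed_set_extend_sorted (g : 'Hom(V, R^o)) (S : set V) (T : seq V) :
  sorted (fun a b => g a <= g b) T ->
  {in T, forall b, b \in Phi /\ 0 < g b} ->
  (forall a b, S a -> b \in T ->
     [/\ a \in Phi, ~ (exists2 c : R, c < 0 & b = c *: a) &
     forall s t : R, 1 <= s -> 1 <= t -> s *: a + t *: b \in Phi ->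
      S (s *: a + t *: b)]) ->
  (forall a b (s t : R), a \in T -> b \in T -> 1 <= s -> 1 <= t ->
     s *: a + t *: b \in Phi ->
     S (s *: a + t *: b) \/ s *: a + t *: b \in T) ->
  forall x (r : R), 0 <= r -> fixed_set S x ->
  (forall b k, b \in T -> K b k -> `|rho k x - x| <= r) ->
  exists2 c, fixed_set (S `|` [set` T]) c & `|c - x| <= 4 ^+ size T * r.
Proof.
elim: T => [|b T IH] sT TPhi ST TT x r r0 Sx Tx.
  by exists x; [move=> a [/Sx//|]|rewrite subrr normr0 mul1r].
have /= sT' := path_sorted sT.
have minb a : a \in T -> g b <= g a.
  by move: sT => /=; rewrite path_sortedE => [/andP[/allP + _]|? ? ?]; [apply|exact: le_trans].
have [Phib gb] := TPhi b (mem_head _ _).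
have inT a : a \in T -> a \in b :: T by rewrite in_cons orbC => ->.
have [|a c Sa Tc|a c s t Ta Tc s1 t1 Phiac|a k Ta|c Tc cx] := IH sT' _ _ _ x r r0 Sx.
- by move=> a /inT; exact: TPhi.
- by apply: ST => //; exact: inT.
- have [|] := TT a c s t (inT _ Ta) (inT _ Tc) s1 t1 Phiac; first by left.
  rewrite in_cons => /predU1P[acb|]; last by right.
  have [_ ga] := TPhi a (inT _ Ta); have [_ gc] := TPhi c (inT _ Tc).
  have := minb a Ta; rewrite -acb functional_comb => gac; exfalso.
  have := ler_wpM2r (ltW ga) s1; have := ler_wpM2r (ltW gc) t1.
  rewrite !mul1r; lra.
- by apply: Tx; exact: inT.
have ck k : K b k -> `|rho k c - c| <= (2 * 4 ^+ size T + 1) * r.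
  move=> Kk; have := Tx b k (mem_head _ _) Kk.
  have := ler_distD (rho k x) (rho k c) c; have := ler_distD x (rho k x) c.
  rewrite action_dist// (distrC x); lra.
have [Ksub _ _] := gradedK.
have [|d [Sd dc Kd]] := fixed_point_of_small_orbit (Ksub b Phib)
  (@fixed_set_closed (S `|` [set` T])) (@fixed_set_midpoint _) _ Tc ck.
  move=> k y Kk; apply: (fixed_set_stable Phib) Kk => a [Sa|/= Ta].
    by have [Phia nab Sab] := ST a b Sa (mem_head _ _); split=> // s t s1 t1 /(Sab s t s1 t1); left.
  have [Phia ga] := TPhi a (inT _ Ta); split => //.
    by move=> [l l0 bl]; move: gb; rewrite bl functionalZ pmulr_lgt0//; lra.
  move=> s t s1 t1 Phiab; have [|] := TT a b s t (inT _ Ta) (mem_head _ _) s1 t1 Phiab; first by left.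
  rewrite in_cons => /predU1P[abb|]; last by right.
  have := ler_wpM2r (ltW ga) s1; have := ler_wpM2r (ltW gb) t1.
  by have := functional_comb g s t a b; rewrite abb !mul1r; lra.
exists d; last first.
  have p1 : 1 <= 4 ^+ size T :> R by rewrite exprn_ege1// ler1n.
  have := ler_wpM2r r0 p1; have := ler_distD c d x; rewrite [size _]/= exprS; lra.
move=> a [Sa|]; first by apply: Sd; left.
by rewrite /= in_cons => /predU1P[->//|Ta]; apply: Sd; right.
Qed.

Lemma fixed_set_extend (g : 'Hom(V, R^o)) (S : set V) (T : seq V) :
  {in T, forall b, b \in Phi /\ 0 < g b} ->
  (forall a b, S a -> b \in T ->
     [/\ a \in Phi, ~ (exists2 c : R, c < 0 & b = c *: a) &
     forall s t : R, 1 <= s -> 1 <= t -> s *: a + t *: b \in Phi ->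
      S (s *: a + t *: b)]) ->
  (forall a b (s t : R), a \in T -> b \in T -> 1 <= s -> 1 <= t ->
     s *: a + t *: b \in Phi ->
     S (s *: a + t *: b) \/ s *: a + t *: b \in T) ->
  forall x (r : R), 0 <= r -> fixed_set S x ->
  (forall b k, b \in T -> K b k -> `|rho k x - x| <= r) ->
  exists2 c, fixed_set (S `|` [set` T]) c & `|c - x| <= 4 ^+ size T * r.
Proof.
move=> TPhi ST TT x r r0 Sx Tx.
pose T' := sort (fun a b => g a <= g b) T.
have T'T : T' =i T by exact: mem_sort.
have sT' : sorted (fun a b => g a <= g b) T'.
  by apply: sort_sorted => a b; exact: le_total.
have [|a b Sa|a b s t|b k|c Tc cx] := fixed_set_extend_sorted sT' _ _ _ r0 Sx.
- by move=> b; rewrite T'T; exact: TPhi.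
- by rewrite T'T; exact: ST.
- by rewrite !T'T; exact: TT.
- by rewrite T'T; exact: Tx.
exists c; last by rewrite -(size_sort (fun a b => g a <= g b)).
by move=> a [Sa|/= Ta]; apply: Tc; [left|right; rewrite /= T'T].
Qed.

Hypothesis relK : forall b, b \in Phi -> exists z, forall k, K b k -> rho k z = z.

Lemma bounded_orbit b x : b \in Phi -> exists r : R, 0 <= r /\
  forall k, K b k -> `|rho k x - x| <= r.
Proof.
move=> /relK[z Kz]; exists (2 * `|x - z|); split=> [|k Kk]; first exact: mulr_ge0.
have := ler_distD z (rho k x) x; rewrite -{1}(Kz k Kk) action_dist// (distrC z).
lra.
Qed.

Lemma bounded_orbits (T : seq V) x : {subset T <= Phi} -> exists r : R, 0 <= r /\
  forall b k, b \in T -> K b k -> `|rho k x - x| <= r.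
Proof.
elim: T => [|b T IH] TPhi; first by exists 0.
have [|r [r0 rT]] := IH; first by move=> a Ta; apply: TPhi; rewrite in_cons Ta orbT.
have [s [s0 sb]] := bounded_orbit x (TPhi b (mem_head _ _)).
exists (r + s); split=> [|a k]; first exact: addr_ge0.
rewrite in_cons => /predU1P[->|Ta] Kk.
  by rewrite (le_trans (sb _ Kk))// lerDr.
by rewrite (le_trans (rT _ _ Ta Kk))// lerDl.
Qed.

Definition positive_roots (f : 'Hom(V, R^o)) : set V :=
  [set a | a \in Phi /\ 0 < f a].

Lemma fixed_set_positive_roots f : fixed_set (positive_roots f) !=set0.
Proof.
pose T : seq V := [seq a <- Phi | 0 < f a].
have TPhi : {subset T <= Phi} by move=> a; rewrite mem_filter => /andP[].
have [r [r0 Tr]] := bounded_orbits 0 TPhi.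
have [|//|a b s t|//|c Tc _] := @fixed_set_extend f set0 T _ _ _ 0 r r0 _ Tr.
- by move=> a; rewrite mem_filter => /andP[].
- rewrite !mem_filter => /andP[fa _] /andP[fb _] s1 t1 Phiab; right.
  rewrite Phiab andbT functional_comb addr_gt0// mulr_gt0//; lra.
exists c; apply: fixed_set_sub Tc => a [Phia fa]; right.
by rewrite /= mem_filter fa.
Qed.

End FixedSets.

(** * Near-minimal pairs at a wall and their passage across it *)

Section Wall.
Set Implicit Arguments.
Unset Strict Implicit.
Variables (R : realType) (V : vectType R) (G : groupType).
Variables (Phi : {fset V}) (K : V -> set G).
Hypothesis gradedK : graded_by Phi K.
Variable X : completeNormedModType R.
Hypothesis ucX : uniformly_convex X.
Variable rho : G -> X -> X.
Hypothesis rhoA : affine_isometric_action rho.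
Hypothesis relK : forall b, b \in Phi -> exists z, forall k, K b k -> rho k z = z.
Local Notation pi := (linear_part rho).
Local Notation D := (displacement rho).
Local Notation Fix := (fixed_set K rho).
Local Notation pos := (positive_roots Phi).

Variable C : R.
Hypothesis C0 : 0 <= C.

Section OneWall.
Variable f : 'Hom(V, R^o).
Hypothesis fC : forall b k, b \in Phi -> f b = 0 -> K b k ->
  displacement_bound rho [set h | exists a, [/\ a \in Phi, f a != 0 & K a h]] k C.

Lemma fixed_set_wall (h : 'Hom(V, R^o)) b k x : (forall a, h a = 0 <-> f a = 0) ->
  b \in Phi -> f b = 0 -> K b k -> Fix (pos h) x -> Fix (pos h) (rho k x).
Proof.
move=> hf Phib /hf hb; apply: (fixed_set_stable gradedK rhoA Phib).
move=> a [Phia ha]; split=> //.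
  move=> [c c0 bca]; have : c * h a < 0 by rewrite nmulr_rlt0.
  by rewrite -functionalZ -bca hb ltxx.
move=> s t s1 t1 Phiab; split=> //.
by rewrite functional_comb hb mulr0 addr0 mulr_gt0//; lra.
Qed.

Lemma displacement_of_difference (q1 q2 : X) (b : V) (e : R) :
  Fix (pos f) q1 -> Fix (pos (- f)) q2 -> b \in Phi -> f b = 0 ->
  (forall k, K b k -> `|(rho k q1 - rho k q2) - (q1 - q2)| <= e) ->
  forall k, K b k -> `|rho k q1 - q1| <= 2 * C * e.
Proof.
move=> Fq1 Fq2 Phib fb Ke.
have [Ksub _ _] := gradedK; have [K1 KV] := Ksub b Phib.
have KM k : K b k -> K b (k * k)%g.
  move=> Kk; rewrite -[X in (_ * X)%g]invgK; apply: (KV) => //.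
  by rewrite -[X in K b X]mul1g; exact: KV.
have e0 : 0 <= e by rewrite (le_trans _ (Ke _ K1)).
have ff a : f a = 0 <-> f a = 0 by [].
have fN a : (- f) a = 0 <-> f a = 0.
  by rewrite opp_lfunE; split=> [/eqP|->]; rewrite ?oppr0// oppr_eq0 => /eqP.
(* [w] is invariant under the roots with [0 < f], and within [e] of [u], which is invariant under
   the other roots off the wall. So all of them move [w] by at most [2 * e], and [fC] applies. *)
have small k : K b k -> `|pi k (rho k q1 - q1) - (rho k q1 - q1)| <= 2 * C * e.
  move=> Kk; have e20 : 0 <= 2 * e by rewrite mulr_ge0.
  rewrite -mulrA mulrCA; apply: (fC Phib fb Kk e20) => h [a [Phia fa Kh]].
  set w := rho k q1 - q1; have := Ke k Kk.
  have fixd q : rho h q = q -> rho h (rho k q) = rho k q -> pi h (rho k q - q) = rho k q - q.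
    by move=> hq hkq; rewrite linear_part_sub// hq hkq.
  have [fagt|fale] := ltP 0 (f a).
    rewrite /displacement fixd ?subrr ?normr0//.
      exact: (Fq1 a (conj Phia fagt)).
    exact: (fixed_set_wall ff Phib fb Kk Fq1 (conj Phia fagt)).
  have falt : 0 < (- f) a by rewrite opp_lfunE oppr_gt0 lt_def eq_sym fa.
  set u := rho k q2 - q2.
  have hu : pi h u = u.
    apply: fixd; first exact: (Fq2 a (conj Phia falt)).
    exact: (fixed_set_wall fN Phib fb Kk Fq2 (conj Phia falt)).
  have -> : rho k q1 - rho k q2 - (q1 - q2) = w - u.
    by rewrite /w /u !opprD addrACA.
  have := ler_distD (pi h u) (pi h w) w.
  by rewrite -linear_partB// norm_linear_part// hu (distrC u) /displacement; lra.
pose S := [set `|rho k q1 - q1| | k in K b].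
have [r [r0 rP]] := bounded_orbit rhoA relK q1 Phib.
have Ssup : has_sup S.
  by split; [exists `|rho 1%g q1 - q1|, 1%g|exists r => _ [k Kk <-]; exact: rP].
(* Doubling: [k * k] displaces [q1] by [pi k w + w], which is within [2 * C * e] of [2 *: w]. So
   twice any displacement is at most [sup S + 2 * C * e]; as the supremum is finite, it is at most
   [2 * C * e]. *)
have half k : K b k -> `|rho k q1 - q1| <= (sup S + 2 * C * e) / 2.
  move=> Kk; have : `|rho (k * k)%g q1 - q1| <= sup S.
    by apply: ub_le_sup; [case: Ssup|exists (k * k)%g => //; exact: KM].
  have := small k Kk; rewrite actionM//.
  have -> : rho k (rho k q1) = pi k (rho k q1 - q1) + rho k q1.
    by rewrite linear_part_sub// subrK.
  set w := rho k q1 - q1; rewrite -[pi k w + rho k q1 - q1]addrA -/w.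
  have := ler_normD (pi k w + w) (w - pi k w).
  have -> : (pi k w + w) + (w - pi k w) = 2 *: w.
    by rewrite addrC addrA subrK scaler_nat mulr2n.
  rewrite normrZ ger0_norm// (distrC w). lra.
have : sup S <= (sup S + 2 * C * e) / 2.
  by apply: ge_sup; [case: Ssup|move=> _ [k Kk <-]; exact: half].
by move=> supS k Kk; have := half k Kk; lra.
Qed.

(** If [k] moved [q1 - q2] by more than [e1 * r], replacing each [q] by the midpoint of [q] and
    [rho k q], still in its fixed set, would shrink the gap by a factor [1 - d]. A small slope
    [sigma] forbids this, and [displacement_of_difference] then bounds the displacements. *)
Lemma near_minimal_displacement (eta : R) : 0 < eta ->
  exists sigma : R, 0 < sigma /\ forall (r : R) (q1 q2 : X), 0 < r ->
    Fix (pos f) q1 -> Fix (pos (- f)) q2 -> `|q1 - q2| <= 2 * r ->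
    (forall x1 x2, Fix (pos f) x1 -> Fix (pos (- f)) x2 ->
      `|q1 - q2| <= `|x1 - x2| + sigma * (`|q1 - x1| + `|q2 - x2|) + sigma * r) ->
    forall b k, b \in Phi -> f b = 0 -> K b k ->
      `|rho k q1 - q1| <= eta * r /\ `|rho k q2 - q2| <= eta * r.
Proof.
have aux1 (e a z r : R) : e * a <= e * (2 * r) -> e * r < z -> e / 2 * a <= z.
  by lra.
have aux3 (x y r : R) : x <= 2 * C * (4 * r) -> y <= (2 * C + 1) * (4 * r) ->
    x / 2 + y / 2 <= (8 * C + 2) * r by lra.
have aux2 (s m t d e sigma r : R) : s <= m + t + sigma * r -> m <= (1 - d) * s ->
    t <= sigma * ((8 * C + 2) * r) -> d * (e * r) < d * (2 * s) ->
    sigma * (8 * C + 3) * r = d * e / 4 * r -> 0 < d * e * r -> False.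
  by lra.
move=> eta0; have C2 : 0 < 2 * C + 1 by have := C0; lra.
pose e1 : R := eta / (2 * C + 1); have e10 : 0 < e1 by exact: divr_gt0.
have e1E : e1 * (2 * C + 1) = eta by rewrite /e1 mulfVK ?gt_eqF.
clearbody e1.
have [|d d0 dP] := uniformly_convex_ball ucX (e := e1 / 2); first lra.
have M0 : 0 < 8 * C + 3 by have := C0; lra.
have s0 : 0 < d * e1 / (4 * (8 * C + 3)) by rewrite divr_gt0// mulr_gt0.
(* The crude bound [4 * r] puts the midpoints at total distance at most [(8 * C + 2) * r], and the
   additive error adds one more [sigma * r]. This loss, [d * e1 * r / 4], is below the gain, [d]
   times a gap exceeding [e1 * r / 2]. *)
exists (d * e1 / (4 * (8 * C + 3))); split => //.
set sigma := _ / _ in s0 * => r q1 q2 r0 Fq1 Fq2 q12 qmin b + Phib fb.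
have sE : sigma * (8 * C + 3) = d * e1 / 4.
  by rewrite /sigma invfM mulrA mulfVK ?gt_eqF.
have second e : (forall k, K b k ->
    `|(rho k q1 - rho k q2) - (q1 - q2)| <= e) -> forall k, K b k ->
    `|rho k q1 - q1| <= 2 * C * e /\ `|rho k q2 - q2| <= (2 * C + 1) * e.
  move=> Ke k Kk; have := displacement_of_difference Fq1 Fq2 Phib fb Ke Kk.
  have := Ke k Kk; rewrite opprD addrACA -opprD => h1 h2; split => //.
  by have := ler_normB (rho k q1 - q1) (rho k q1 - q1 - (rho k q2 - q2));
    rewrite subKr; lra.
have trivial k : K b k -> `|(rho k q1 - rho k q2) - (q1 - q2)| <= 4 * r.
  move=> Kk; rewrite (le_trans (ler_normB _ _))// action_dist//; lra.
suff kdiff k : K b k -> `|(rho k q1 - rho k q2) - (q1 - q2)| <= e1 * r.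
  move=> k /(second _ kdiff)[h1 h2]; have e1r : 0 < e1 * r by exact: mulr_gt0.
  by split; rewrite -e1E; lra.
move=> Kk; rewrite leNgt; apply/negP => far.
have [loc1 loc2] := second _ trivial k Kk.
set a := rho k q1 - rho k q2 in far; set a' := q1 - q2 in far q12 qmin.
have na : `|a| = `|a'| by exact: action_dist.
have big : e1 * r < 2 * `|a'|.
  by have := ler_normB a a'; rewrite na; lra.
have a'0 : 0 < `|a'| by have := mulr_gt0 e10 r0; lra.
have := dP `|a'| a a' a'0; rewrite na lexx => /(_ isT isT).
have -> : 2^-1 *: (a + a') = 2^-1 *: (q1 + rho k q1) - 2^-1 *: (q2 + rho k q2).
  by rewrite [a + a']addrC -scalerBr [in RHS]opprD [in RHS]addrACA.
have := qmin _ _ (fixed_set_midpoint rhoA Fq1 (fixed_set_wall (fun=> conj id id) Phib fb Kk Fq1)).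
have fN c : (- f) c = 0 <-> f c = 0.
  by rewrite opp_lfunE; split=> [/eqP|->]; rewrite ?oppr0// oppr_eq0 => /eqP.
move=> /(_ _ (fixed_set_midpoint rhoA Fq2 (fixed_set_wall fN Phib fb Kk Fq2))).
have half q : `|q - 2^-1 *: (q + rho k q)| = `|rho k q - q| / 2.
  have {1}-> : q = 2^-1 *: (q + q).
    by rewrite scalerDr -scalerDl -div1r -splitr scale1r.
  by rewrite -scalerBr opprD addrACA subrr add0r normr_half distrC.
rewrite !half; set m := `|_ - _| => h1 h2.
have e1a : e1 / 2 * `|a'| <= `|a - a'|.
  exact: aux1 (ler_wpM2l (ltW e10) q12) far.
have {}h2 := h2 e1a.
have hs : sigma * (`|rho k q1 - q1| / 2 + `|rho k q2 - q2| / 2) <= sigma * ((8 * C + 2) * r).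
  by apply: ler_wpM2l (ltW s0) _ _ (aux3 _ _ _ loc1 loc2).
have far2 : d * (e1 * r) < d * (2 * `|a'|) by rewrite ltr_pM2l.
by apply: aux2 h1 h2 hs far2 (congr1 ( *%R^~ r) sE) _; rewrite !mulr_gt0.
Qed.

End OneWall.

(** These are the positive roots of [f + t *: g] for all small enough [t > 0], so this encodes a
    chamber adjacent to the wall containing [f]. *)
Definition chamber (f g : 'Hom(V, R^o)) : set V :=
  [set a | a \in Phi /\ (0 < f a \/ f a = 0 /\ 0 < g a)].

Lemma fixed_set_chamber_sub f g : Fix (chamber f g) `<=` Fix (pos f).
Proof. by apply: fixed_set_sub => a [Phia fa]; split=> //; left. Qed.

Lemma fixed_set_chamber_near f g q (r : R) : 0 <= r -> Fix (pos f) q ->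
  (forall b k, b \in Phi -> f b = 0 -> K b k -> `|rho k q - q| <= r) ->
  exists2 c, Fix (chamber f g) c & `|c - q| <= 4 ^+ size Phi * r.
Proof.
move=> r0 Fq small; pose T : seq V := [seq a <- Phi | (f a == 0) && (0 < g a)].
have TE a : a \in T -> [/\ f a = 0, 0 < g a & a \in Phi].
  by rewrite mem_filter => /andP[/andP[/eqP ? ?] ?].
have [|a b [Phia fa] /TE[fb gb Phib]|a b s t|b k|c Tc cq] :=
    @fixed_set_extend _ _ _ _ _ gradedK _ ucX _ rhoA g (pos f) T _ _ _ q r r0 Fq.
- by move=> b /TE[].
- split=> //.
    move=> [c c0 bca]; have : c * f a < 0 by rewrite nmulr_rlt0.
    by rewrite -functionalZ -bca fb ltxx.
  move=> s t s1 t1 Phiab; split=> //.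
  by rewrite functional_comb fb mulr0 addr0 mulr_gt0//; lra.
- move=> /TE[fa ga Phia] /TE[fb gb Phib] s1 t1 Phiab; right.
  rewrite mem_filter Phiab andbT !functional_comb fa fb !mulr0 addr0 eqxx/=.
  by rewrite addr_gt0// mulr_gt0//; lra.
- by move=> /TE[fb gb Phib]; exact: small.
exists c; last first.
  rewrite (le_trans cq)// ler_wpM2r// ler_eXn2l ?ltr1n// size_filter count_size//.
apply: fixed_set_sub Tc => a [Phia [fa|[fa ga]]]; first by left.
by right; rewrite /= mem_filter fa eqxx ga.
Qed.

Definition gap (p : X * X) : R := `|p.1 - p.2|.
Definition pair_dist (p q : X * X) : R := `|p.1 - q.1| + `|p.2 - q.2|.

Lemma pair_dist_triangle p q s : pair_dist p s <= pair_dist p q + pair_dist q s.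
Proof. by rewrite /pair_dist addrACA lerD ?ler_distD. Qed.

Lemma gap_pair_dist p q : gap q <= gap p + pair_dist p q.
Proof.
have := ler_distD p.1 q.1 q.2; have := ler_distD p.2 p.1 q.2.
by rewrite /gap /pair_dist (distrC q.1 p.1); lra.
Qed.

(** Ekeland's idea: [x] minimizes the gap plus the penalty [sigma * pair_dist p x] up to [e], and
    the triangle inequality moves the base point of the penalty from [p] to [x]. Keeping [q] when it
    is already good enough ensures the comparison with [q]. *)
Lemma almost_minimizer (Q : set (X * X)) p q (sigma e : R) :
  0 <= sigma -> 0 < e -> Q q -> exists x, [/\ Q x,
    gap x + sigma * pair_dist p x <= gap q + sigma * pair_dist p q &
    forall y, Q y -> gap x <= gap y + sigma * pair_dist x y + e].
Proof.
move=> s0 e0 Qq; pose F x := gap x + sigma * pair_dist p x.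
have F0 x : 0 <= F x by rewrite addr_ge0 ?normr_ge0// mulr_ge0// addr_ge0.
pose S := [set F x | x in Q].
have Sinf : has_inf S.
  by split; [exists (F q), q|exists 0 => _ [x _ <-]; exact: F0].
have nearmin x : F x <= inf S + e ->
    forall y, Q y -> gap x <= gap y + sigma * pair_dist x y + e.
  move=> Fx y Qy; have : inf S <= F y by apply: ge_inf; [case: Sinf|exists y].
  have := ler_wpM2l s0 (pair_dist_triangle p x y); rewrite /F in Fx *; lra.
have [Fq|Fq] := leP (F q) (inf S + e); first by exists q; split=> //; exact: nearmin.
have [_ [x Qx <-] xS] := inf_adherent e0 Sinf.
by exists x; split=> //; [exact: ltW (lt_trans xS Fq)|exact: nearmin (ltW xS)].
Qed.

Definition fixed_pairs (S T : set V) : set (X * X) :=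
  [set p | Fix S p.1 /\ Fix T p.2].

(* Ekeland-type near-minimality: a pair [p] with [gap p] close to [r] almost
   minimizes the gap over [fixed_pairs S T], up to slope and relative error
   [kappa]; the minimum itself need not be attained. *)
Definition gap_bound (S T : set V) (p : X * X) (r kappa : R) : Prop :=
  forall q, fixed_pairs S T q ->
    r - kappa * pair_dist p q - kappa * r <= gap q.

Section Crossing.
Variable f : 'Hom(V, R^o).
Hypothesis fC : forall b k, b \in Phi -> f b = 0 -> K b k ->
  displacement_bound rho [set h | exists a, [/\ a \in Phi, f a != 0 & K a h]] k C.
Local Notation c := (4 ^+ size Phi : R).

Lemma fixed_pairs_chamber_near h q (e : R) : 0 <= e ->
  fixed_pairs (pos f) (pos (- f)) q ->
  (forall b k, b \in Phi -> f b = 0 -> K b k ->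
    `|rho k q.1 - q.1| <= e /\ `|rho k q.2 - q.2| <= e) ->
  exists2 x, fixed_pairs (chamber f h) (chamber (- f) (- h)) x &
    pair_dist q x <= 2 * c * e.
Proof.
move=> e0 [Fq1 Fq2] small.
have [|x1 Fx1 qx1] := @fixed_set_chamber_near f h q.1 e e0 Fq1.
  by move=> b k Phib fb Kk; have [] := small b k Phib fb Kk.
have [|x2 Fx2 qx2] := @fixed_set_chamber_near (- f) (- h) q.2 e e0 Fq2.
  move=> b k Phib; rewrite opp_lfunE => /eqP; rewrite oppr_eq0 => /eqP fb Kk.
  by have [] := small b k Phib fb Kk.
exists (x1, x2) => //=.
by rewrite /pair_dist /= (distrC q.1) (distrC q.2); lra.
Qed.

(** A pair violating the bound at the wall yields, by [almost_minimizer], a near-minimal [x] that is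
    at least as bad. The wall roots barely move [x], so it is close to a pair for the chamber, which
    violates the bound assumed there. The constant 32 makes this distance at most
    [kappa' * r / 16]. *)
Lemma gap_bound_wall g (kappa' : R) : 0 < kappa' -> kappa' <= 1 ->
  exists kappa, [/\ 0 < kappa, kappa <= 1 & forall p r, 0 < r ->
    gap_bound (chamber f g) (chamber (- f) (- g)) p r kappa ->
    gap_bound (pos f) (pos (- f)) p r kappa'].
Proof.
move=> k0 k1; have c0 : 0 < c by rewrite exprn_gt0.
pose eta : R := kappa' / (32 * c).
have eta0 : 0 < eta by rewrite divr_gt0// mulr_gt0.
have etaE : 32 * (c * eta) = kappa' by rewrite mulrA mulrC /eta mulfVK// gt_eqF// mulr_gt0.
have [sigma [s0 near]] := near_minimal_displacement fC eta0.
pose s := Num.min sigma kappa'.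
have sgt0 : 0 < s by rewrite lt_min s0.
have ss : s <= sigma by rewrite ge_min lexx.
have sk : s <= kappa' by rewrite ge_min lexx orbT.
pose kappa := Num.min s (kappa' / 4).
have kgt0 : 0 < kappa by rewrite lt_min sgt0 divr_gt0.
have ks : kappa <= s by rewrite ge_min lexx.
have kk : kappa <= kappa' / 4 by rewrite ge_min lexx orbT.
exists kappa; split=> //; first lra.
move=> p r r0 gb q Fq; rewrite leNgt; apply/negP => small.
have [x [Fx xq xmin]] := almost_minimizer p (ltW sgt0) (mulr_gt0 sgt0 r0) Fq.
have d0 y z : 0 <= pair_dist y z by rewrite addr_ge0.
have gx : gap x <= r.
  have := mulr_ge0 (ltW sgt0) (d0 p x); have := ler_wpM2r (d0 p q) sk.
  have := mulr_gt0 k0 r0; lra.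
have r2 : gap x <= 2 * r by lra.
have [||y Fy xy] := @fixed_pairs_chamber_near g x (eta * r) _ Fx.
- by rewrite mulr_ge0// ltW.
- move=> b k Phib fb Kk; have [Fx1 Fx2] := Fx.
  apply: (near _ _ _ r0 Fx1 Fx2 r2 _ b) => // x1 x2 Fx1' Fx2'.
  have := xmin (x1, x2) (conj Fx1' Fx2'); rewrite /pair_dist/=.
  have := ler_wpM2r (ltW r0) ss; have := ler_wpM2r (d0 x (x1, x2)) ss.
  rewrite /pair_dist /gap/=; lra.
have ry := gb y Fy; have gxy := gap_pair_dist x y.
have pxy := ler_wpM2l (ltW kgt0) (pair_dist_triangle p x y).
have kpx := ler_wpM2r (d0 p x) ks; have kpq := ler_wpM2r (d0 p q) sk.
have kr := ler_wpM2r (ltW r0) kk; have k'r := mulr_gt0 k0 r0.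
have E : 32 * (c * (eta * r)) = kappa' * r by rewrite -etaE; ring.
have k1' : kappa <= 1 by lra.
have := ler_wpM2r (d0 x y) k1'; lra.
Qed.

(** [gap_bound_wall] carries the bound from one chamber to the wall, and inclusion of fixed sets
    carries it on to the other chamber. The pair [q] close to [p] is near-minimal at the wall, so
    the wall roots barely move it and it can be corrected to a pair of the other chamber. *)
Lemma wall_crossing g (kappa' : R) : 0 < kappa' -> kappa' <= 1 ->
  exists kappa, [/\ 0 < kappa, kappa <= kappa' & forall p r, 0 < r -> gap p <= r ->
    gap_bound (chamber f (- g)) (chamber (- f) g) p r kappa ->
    (exists2 q, fixed_pairs (chamber f (- g)) (chamber (- f) g) q &
      pair_dist p q <= kappa * r) ->
    gap_bound (chamber f g) (chamber (- f) (- g)) p r kappa' /\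
    exists2 q, fixed_pairs (chamber f g) (chamber (- f) (- g)) q &
      pair_dist p q <= kappa' * r].
Proof.
move=> k0 k1; have c0 : 0 < c by rewrite exprn_gt0.
pose eta : R := kappa' / (8 * c).
have eta0 : 0 < eta by rewrite divr_gt0// mulr_gt0.
have etaE : 8 * (c * eta) = kappa' by rewrite mulrA mulrC /eta mulfVK// gt_eqF// mulr_gt0.
have [sigma [s0 near]] := near_minimal_displacement fC eta0.
pose kappa1 := Num.min kappa' (sigma / 4).
have k10 : 0 < kappa1 by rewrite lt_min k0 divr_gt0.
have k1k : kappa1 <= kappa' by rewrite ge_min lexx.
have k1s : kappa1 <= sigma / 4 by rewrite ge_min lexx orbT.
have [|kappa2 [k20 k21 bound]] := gap_bound_wall (- g) k10; first exact: le_trans k1k k1.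
rewrite opprK in bound.
pose kappa := Num.min kappa2 (Num.min (kappa' / 4) (sigma / 4)).
have kgt0 : 0 < kappa by rewrite !lt_min k20 !divr_gt0.
have kk2 : kappa <= kappa2 by rewrite ge_min lexx.
have kk : kappa <= kappa' / 4 by rewrite !ge_min lexx !orbT.
have ks : kappa <= sigma / 4 by rewrite !ge_min lexx !orbT.
have d0 y z : 0 <= pair_dist y z by rewrite addr_ge0.
exists kappa; split=> //; first lra.
move=> p r r0 pr gb [q Fq pq].
have {}gb : gap_bound (pos f) (pos (- f)) p r kappa1.
  apply: bound => // y /gb; have := ler_wpM2r (d0 p y) kk2.
  have := ler_wpM2r (ltW r0) kk2; lra.
have Fq' : fixed_pairs (pos f) (pos (- f)) q.
  by case: Fq => Fq1 Fq2; split; [exact: fixed_set_chamber_sub Fq1|exact: fixed_set_chamber_sub Fq2].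
split.
  move=> y [Fy1 Fy2]; have /gb : fixed_pairs (pos f) (pos (- f)) y.
    by split; [exact: fixed_set_chamber_sub Fy1|exact: fixed_set_chamber_sub Fy2].
  have := ler_wpM2r (d0 p y) k1k; have := ler_wpM2r (ltW r0) k1k; lra.
have kr1 := ler_wpM2r (ltW r0) kk; have kr2 := ler_wpM2r (ltW r0) ks.
have k1r := ler_wpM2r (ltW r0) k1s; have k'r := ler_wpM2r (ltW r0) k1.
have gq := gap_pair_dist p q.
have q2 : gap q <= 2 * r by lra.
have er0 : 0 <= eta * r by rewrite mulr_ge0// ltW.
have [|y Fy qy] := @fixed_pairs_chamber_near g q (eta * r) er0 Fq'.
  move=> b k Phib fb Kk; have [Fq1 Fq2] := Fq'.
  apply: (near _ _ _ r0 Fq1 Fq2 q2 _ b) => // x1 x2 Fx1 Fx2.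
  suff : gap q <= gap (x1, x2) + sigma * pair_dist q (x1, x2) + sigma * r by [].
  have := gb (x1, x2) (conj Fx1 Fx2).
  have k1pq := ler_wpM2l (ltW k10) (pair_dist_triangle p q (x1, x2)).
  have k11 : kappa1 <= 1 by lra.
  have k1d := ler_wpM2r (d0 p q) k11.
  have := ler_wpM2r (d0 q (x1, x2)) k1s; have := mulr_ge0 (ltW s0) (d0 q (x1, x2)).
  have := mulr_gt0 s0 r0; lra.
exists y => //; have := pair_dist_triangle p q y.
have E : 8 * (c * (eta * r)) = kappa' * r by rewrite -etaE; ring.
have := mulr_gt0 k0 r0; lra.
Qed.

End Crossing.
End Wall.

(** * From crossing to the opposite chamber to a common fixed point *)

Section Contraction.
Set Implicit Arguments.
Unset Strict Implicit.
Variables (R : realType) (V : vectType R) (G : groupType) (K : V -> set G).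
Variables (X : completeNormedModType R) (rho : G -> X -> X).
Hypothesis rhoA : affine_isometric_action rho.
Local Notation Fix := (fixed_set K rho).
Local Notation pairs := (fixed_pairs K rho).
Local Notation bound := (gap_bound K rho).

(** Tolerances are quantified backwards, [kappa] after [kappa'], so that crossings compose along a
    path while the reference pair [p] and the scale [r] stay the same. *)
Definition crossing (S S' T T' : set V) : Prop :=
  forall kappa' : R, 0 < kappa' -> kappa' <= 1 ->
  exists kappa, [/\ 0 < kappa, kappa <= kappa' & forall p r, 0 < r -> gap p <= r ->
    bound S S' p r kappa ->
    (exists2 q, pairs S S' q & pair_dist p q <= kappa * r) ->
    bound T T' p r kappa' /\
    exists2 q, pairs T T' q & pair_dist p q <= kappa' * r].

Lemma crossing_refl S S' : crossing S S' S S'.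
Proof. by move=> k k0 k1; exists k; split. Qed.

Lemma crossing_trans S S' T T' W W' :
  crossing S S' T T' -> crossing T T' W W' -> crossing S S' W W'.
Proof.
move=> ST TW k k0 k1; have [k' [k'0 k'k TWk]] := TW k k0 k1.
have [k'' [k''0 k''k STk]] := ST k' k'0 (le_trans k'k k1).
exists k''; split=> //; first exact: le_trans k'k.
by move=> p r r0 pr b q; have [] := STk p r r0 pr b q; exact: TWk.
Qed.

Lemma pair_dist_ge0 (p q : X * X) : 0 <= pair_dist p q.
Proof. exact: addr_ge0. Qed.

(** After the crossing, [q.1] lies in [Fix S'] but is close to [p.1] in [Fix S]. Thus [(p.1, q.1)]
    competes with [p], with gap at most [gap p / 8]. *)
Lemma crossing_not_minimal S S' : crossing S S' S' S ->
  exists kappa : R, 0 < kappa /\ forall p, pairs S S' p -> 0 < gap p ->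
    ~ bound S S' p (gap p) kappa.
Proof.
move=> SS'; have [||k [k0 k8 kP]] := SS' (1 / 8); [lra|lra|].
exists k; split=> // p Fp p0 pb.
have [|_ [q [Fq1 Fq2] pq]] := kP p (gap p) p0 (lexx _) pb.
  exists p => //; rewrite /pair_dist !subrr !normr0 addr0.
  by rewrite mulr_ge0// ltW.
have [Fp1 Fp2] := Fp.
have := pb (p.1, q.1) (conj Fp1 Fq1).
have p1q1 : `|p.1 - q.1| <= 1 / 8 * gap p.
  by rewrite (le_trans _ pq)// /pair_dist lerDl.
have : pair_dist p (p.1, q.1) <= gap p + 1 / 8 * gap p.
  rewrite /pair_dist /= subrr normr0 add0r.
  have := ler_distD p.1 p.2 q.1; rewrite (distrC p.2 p.1) -[ `|p.1 - p.2| ]/(gap p).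
  by lra.
move=> /(ler_wpM2l (ltW k0)); have := ler_wpM2r (ltW p0) k8.
rewrite -[ `|p.1 - q.1| ]/(gap (p.1, q.1)) in p1q1; lra.
Qed.

(** Take [q] from [almost_minimizer] with slope [k / 4] and error [k / 4 * gap p]. Were
    [gap q > gap p / 2], that error would be below [k / 2 * gap q], and [q] would satisfy the bound
    excluded by [crossing_not_minimal]. The slope gives the constant [4 / k]. *)
Lemma crossing_contraction S S' : crossing S S' S' S ->
  exists M : R, 0 < M /\ forall p, pairs S S' p -> exists q,
    [/\ pairs S S' q, gap q <= gap p / 2 & pair_dist p q <= M * gap p].
Proof.
move=> /crossing_not_minimal[k [k0 kP]]; exists (4 / k); split; first exact: divr_gt0.
move=> p Fp; have [gp_eq0|gp_neq0] := eqVneq (gap p) 0.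
  exists p; split=> //; first by rewrite gp_eq0 mul0r.
  by rewrite gp_eq0 mulr0 /pair_dist !subrr !normr0 addr0.
have gp0 : 0 < gap p by rewrite lt_def gp_neq0 normr_ge0.
have s0 : 0 <= k / 4 by rewrite ltW// divr_gt0.
have e0 : 0 < k / 4 * gap p by rewrite mulr_gt0// divr_gt0.
have [q [Fq qp qmin]] := almost_minimizer p s0 e0 Fp.
have pp : pair_dist p p = 0 by rewrite /pair_dist !subrr !normr0 addr0.
rewrite pp mulr0 addr0 in qp.
have qge0 : 0 <= gap q := normr_ge0 _.
have sd := mulr_ge0 s0 (pair_dist_ge0 p q).
exists q; split=> //; last first.
  by rewrite mulrAC ler_pdivlMr//; lra.
rewrite leNgt; apply/negP => q2; have gq0 : 0 < gap q by lra.
apply: (kP q Fq gq0) => y Fy; have := qmin y Fy.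
have := mulr_ge0 s0 (pair_dist_ge0 q y).
have := mulr_gt0 k0 gp0; have := mulr_gt0 k0 gq0.
have : k * (gap p / 2) < k * gap q by rewrite ltr_pM2l.
lra.
Qed.

(** Iterating the contraction halves the gap and moves the pair by at most [M] times the current
    gap, so the first components are Cauchy. As the gap tends to 0, their limit is also that of the
    second components, and lies in both closed fixed sets. *)
Lemma crossing_fixed_point S S' : crossing S S' S' S ->
  Fix S !=set0 -> Fix S' !=set0 -> exists x, Fix S x /\ Fix S' x.
Proof.
move=> /crossing_contraction[M [M0 step]] [x1 Fx1] [x2 Fx2].
have /choice[nxt nxtP] p : exists q, pairs S S' p ->
    [/\ pairs S S' q, gap q <= gap p / 2 & pair_dist p q <= M * gap p].
  have [Fp|nFp] := pselect (pairs S S' p); last by exists p.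
  by have [q qP] := step p Fp; exists q.
pose p n := iter n nxt (x1, x2).
have Fp n : pairs S S' (p n) by elim: n => [|n /nxtP[]].
have gp n : gap (p n) <= gap (p 0%N) * 2^-1 ^+ n.
  elim: n => [|n IH]; first by rewrite mulr1.
  have [_ + _] := nxtP _ (Fp n); rewrite exprSr mulrA -/(p n.+1); lra.
have tail n k : `|(p (n + k)%N).1 - (p n).1| <= 2 * M * gap (p n).
  elim: k n => [|k IH] n.
    by rewrite addn0 subrr normr0 mulr_ge0 ?normr_ge0// mulr_ge0// ltW.
  have [_ h1 h2] := nxtP _ (Fp n); have := IH n.+1.
  rewrite addSnnS -[p n.+1]/(nxt (p n)).
  have := ler_distD (nxt (p n)).1 (p (n + k.+1)%N).1 (p n).1.
  have : `|(nxt (p n)).1 - (p n).1| <= M * gap (p n).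
    by rewrite (le_trans _ h2)// /pair_dist distrC lerDl.
  have := ler_wpM2l (ltW M0) h1; lra.
have small (e : R) : 0 < e -> exists N, forall n, (N <= n)%N ->
    gap (p n) < e /\ `|(p n).1 - (p N).1| < e.
  move=> e0; have q2 : 0 <= (2^-1 : R) <= 2^-1 by rewrite lexx invr_ge0 ler0n.
  have [N NP] := geometric_lt ((2 * M + 1) * gap (p 0%N)) q2 e0.
  have NP' : (2 * M + 1) * gap (p N) < e.
    rewrite (le_lt_trans _ NP)// -mulrA ler_wpM2l//; lra.
  have gN : 0 <= gap (p N) := normr_ge0 _.
  have MgN := mulr_ge0 (ltW M0) gN.
  exists N => n /subnKC<-; split; last by have := tail N (n - N)%N; lra.
  have : gap (p (N + (n - N))%N) <= gap (p N); last lra.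
  elim: (n - N)%N => [|k IH]; first by rewrite addn0.
  have [_ + _] := nxtP _ (Fp (N + k)%N); rewrite addnS -[p (_).+1]/(nxt (p (N + k)%N)).
  have : 0 <= gap (p (N + k)%N) := normr_ge0 _; lra.
have [|x xP] := @cauchy_seq_limit R X (fun n => (p n).1).
  move=> e e0; have [|N NP] := small (e / 2); first lra.
  exists N => n m /NP[_ Nn] /NP[_ Nm].
  have := ler_distD (p N).1 (p n).1 (p m).1; rewrite (distrC (p N).1 (p m).1); lra.
exists x; split; apply: fixed_set_closed => // e e0.
  have [N NP] := xP e e0; exists (p N).1; last exact: NP.
  by have [] := Fp N.
have e20 : 0 < e / 2 by lra.
have [N NP] := xP _ e20; have [M' M'P] := small _ e20.
pose n := maxn N M'; exists (p n).2; first by have [] := Fp n.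
have := NP n (leq_maxl _ _); have [+ _] := M'P n (leq_maxr _ _).
have := ler_distD (p n).1 (p n).2 x; rewrite (distrC (p n).2 (p n).1) /gap; lra.
Qed.

End Contraction.

(** * Functionals in general position *)

Section Functionals.
Set Implicit Arguments.
Unset Strict Implicit.
Variables (R : realType) (V : vectType R).
Implicit Types (f g h : 'Hom(V, R^o)) (v w : V).

Lemma functional_neq0 v : v != 0 -> exists h, h v != 0.
Proof.
move=> v0; apply: contrapT => noh; move/eqP: v0; apply.
rewrite (coord_vbasis (memvf v)) big1// => i _.
have -> : coord (vbasis fullv) i v = 0; last by rewrite scale0r.
apply/eqP; apply: contrapT => /negP ci; apply: noh.
by exists (linfun (coord (vbasis fullv) i : V -> R^o)); rewrite lfunE.
Qed.

Lemma small_perturbation f h (ws : seq V) : exists s : R, 0 < s /\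
  forall t, 0 < t <= s -> {in ws, forall w, 0 < f w -> 0 < (f + t *: h) w}.
Proof.
elim: ws => [|w ws [s [s0 sP]]]; first by exists 1.
have [fw|fw] := leP (f w) 0.
  exists s; split=> // t ts u; rewrite in_cons => /predU1P[->|/(sP t ts)//].
  by move=> /lt_le_trans/(_ fw); rewrite ltxx.
have d0 : 0 < `|h w| + 1 by rewrite ltr_wpDl.
exists (Num.min s (f w / (`|h w| + 1))); split.
  by rewrite lt_min s0 divr_gt0.
move=> t /andP[t0]; rewrite le_min => /andP[ts tw] u.
rewrite in_cons => /predU1P[->|wsu] fu; last by apply: (sP t) => //; rewrite t0.
rewrite ler_pdivlMr// in tw; rewrite add_lfunE scale_lfunE.
have := ler_norm (- h w); rewrite normrN => /(ler_wpM2l (ltW t0)).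
rewrite -[_ *: _]/(t * h w); lra.
Qed.

Lemma generic_functional g (ws vs : seq V) : 0 \notin vs -> exists f,
  {in vs, forall v, f v != 0} /\ {in ws, forall w, 0 < g w -> 0 < f w}.
Proof.
elim: vs => [|v vs IH]; first by exists g; split=> [v|//]; rewrite in_nil.
rewrite in_cons negb_or eq_sym => /andP[v0 /IH[f [fvs fws]]].
have [h hv] := functional_neq0 v0.
(* The negatives of [vs] are listed so that negative values of [f] keep their sign too. *)
have [s [s0 sP]] := small_perturbation f h (ws ++ vs ++ map -%R vs).
have {}sP := sP s; rewrite s0 lexx in sP; have {}sP := sP isT.
have [fv|fv] := eqVneq (f v) 0; last first.
  by exists f; split=> // u; rewrite in_cons => /predU1P[->|/fvs].
exists (f + s *: h); split=> [u|w ws_w gw]; last first.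
  by apply: sP; rewrite ?mem_cat ?ws_w//; exact: fws.
rewrite in_cons => /predU1P[->|vsu].
  by rewrite add_lfunE scale_lfunE fv add0r scaler_eq0 negb_or gt_eqF.
have := fvs u vsu; rewrite neq_lt => /orP[fu|fu].
  rewrite lt_eqF// -oppr_gt0 -linearN; apply: sP.
    by rewrite !mem_cat (map_f _ vsu) !orbT.
  by rewrite linearN oppr_gt0.
by rewrite gt_eqF//; apply: sP => //; rewrite !mem_cat vsu orbT.
Qed.

Lemma positive_functional2 v w : v != 0 -> w \notin <[v]>%VS ->
  exists g, 0 < g v /\ 0 < g w.
Proof.
move=> v0 vw; have fr : free [tuple w; v].
  by rewrite /= free_cons span_seq1 vw /= seq1_free.
exists (linfun (coord [tuple w; v] ord0 : V -> R^o) +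
        linfun (coord [tuple w; v] (lift ord0 ord0) : V -> R^o)).
rewrite !add_lfunE !lfunE /=.
have cw i := coord_free ord0 i fr; have cv i := coord_free (lift ord0 ord0) i fr.
move: (cw ord0) (cw (lift ord0 ord0)) (cv ord0) (cv (lift ord0 ord0)) => /= -> -> -> ->.
by rewrite !add0r !addr0 !ltr01.
Qed.

End Functionals.

(** * Regularity puts every root in a core *)

Section Cores.
Set Implicit Arguments.
Unset Strict Implicit.
Variables (R : realType) (V : vectType R) (Phi : {fset V}).
Hypothesis rootPhi : root_system Phi.
Hypothesis regPhi : regular_root_system Phi.
Implicit Types (a b c : V).

Lemma root_neq0 a : a \in Phi -> a != 0.
Proof. by have [_ _ n0 _] := rootPhi; apply: contraTneq => ->. Qed.

Lemma root_opp a : a \in Phi -> - a \in Phi.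
Proof. by have [_ _ _ <-] := rootPhi. Qed.

Lemma vline_sym a b : b != 0 -> b \in <[a]>%VS -> a \in <[b]>%VS.
Proof.
move=> b0 /vlineP[k bk]; apply/vlineP; exists k^-1.
by rewrite bk scalerK// -unitfE unitfE; apply: contraNneq b0 => k0; rewrite bk k0 scale0r.
Qed.

Lemma scale_root (k : R) b : b \in Phi -> k != 0 ->
  exists s c, [/\ 0 < s, c \in Phi & k *: b = s *: c].
Proof.
move=> Phib; rewrite neq_lt => /orP[k0|k0]; last by exists k, b.
exists (- k), (- b); split; [by rewrite oppr_gt0|exact: root_opp|].
by rewrite scalerN scaleNr opprK.
Qed.

(** If the roots of the rank 2 subsystem [Psi] all lay on the line of [a] and one other line, these
    lines would split [Psi]. So there are roots [b] and [c] on two further lines, and [a] is a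
    combination of them with nonzero coefficients, whose signs are absorbed by passing to negatives
    of roots. *)
Lemma root_between a : a \in Phi -> exists b c (s t : R),
  [/\ b \in Phi, c \in Phi, b \notin <[a]>%VS & c \notin <[a]>%VS] /\
  [/\ 0 < s, 0 < t & a = s *: b + t *: c].
Proof.
move=> Phia; have [Psi [[Psi0 /fsubsetP PsiPhi _] irr dim2 aPsi]] := regPhi Phia.
have a0 := root_neq0 Phia.
have [b bPsi ba] : exists2 b, b \in Psi & b \notin <[a]>%VS.
  apply: contrapT => nb; have : (<<Psi>> <= <[a]>)%VS.
    apply/span_subvP => x xPsi; apply: contrapT => /negP xa.
    by apply: nb; exists x.
  by move=> /dimvS; rewrite dim2 dim_vline; case: (_ != 0).
have b0 := root_neq0 (PsiPhi _ bPsi).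
have ab : a \notin <[b]>%VS by apply: contra ba; exact: vline_sym.
have [c cPsi [ca cb]] : exists2 c, c \in Psi & c \notin <[a]>%VS /\ c \notin <[b]>%VS.
  apply: contrapT => nc; apply: irr.
  have sub1 : (<<[fset x in Psi | x \in <[a]>%VS]%fset>> <= <[a]>)%VS.
    by apply/span_subvP => x; rewrite !inE => /andP[].
  have sub2 : (<<[fset x in Psi | x \in <[b]>%VS]%fset>> <= <[b]>)%VS.
    by apply/span_subvP => x; rewrite !inE => /andP[].
  have cap x : x \in <[a]>%VS -> x \in <[b]>%VS -> x = 0.
    move=> xa xb; apply/eqP; apply: contraNT ba => x0.
    exact: (subvP (_ : (<[x]> <= <[a]>)%VS)) (vline_sym x0 xb).
  exists [fset x in Psi | x \in <[a]>%VS]%fset, [fset x in Psi | x \in <[b]>%VS]%fset.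
  split.
  - by apply/fset0Pn; exists a; rewrite !inE aPsi memv_line.
  - by apply/fset0Pn; exists b; rewrite !inE bPsi memv_line.
  - apply/fdisjointP => x; rewrite !inE => /andP[xPsi xa]; rewrite xPsi /=.
    by apply/negP => /(cap _ xa) x0; have := root_neq0 (PsiPhi _ xPsi); rewrite x0 eqxx.
  - apply/fsetP => x; rewrite !inE -andb_orr.
    have [xPsi|//] := boolP (x \in Psi); rewrite /=; apply/esym.
    apply: contrapT => /negP; rewrite negb_or => /andP[xa xb].
    by apply: nc; exists x.
  - apply/eqP; rewrite -subv0; apply/subvP => x; rewrite memv_cap memv0.
    by move=> /andP[/(subvP sub1) xa /(subvP sub2) xb]; rewrite (cap _ xa xb).
have fr : free [:: a; b] by rewrite free_cons span_seq1 ab seq1_free.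
have spanE : <<[:: a; b]>>%VS = <<Psi>>%VS.
  apply/eqP; rewrite eqEdim dim2 (eqP (fr : _ == _)) andbT.
  by apply/span_subvP => x; rewrite !inE => /orP[]/eqP->; exact: memv_span.
have : c \in <<[:: a; b]>>%VS by rewrite spanE memv_span.
rewrite span_cons span_seq1 => /memv_addP[_ /vlineP[x ->] [_ /vlineP[y ->] cE]].
have x0 : x != 0.
  by apply: contraNneq cb => x0; rewrite cE x0 scale0r add0r memvZ// memv_line.
have y0 : y != 0.
  by apply: contraNneq ca => y0; rewrite cE y0 scale0r addr0 memvZ// memv_line.
have aE : a = (- (x^-1 * y)) *: b + x^-1 *: c.
  by rewrite cE scalerDr !scalerA mulVf// scale1r addrCA scaleNr addNr addr0.
have k0 : - (x^-1 * y) != 0 by rewrite oppr_eq0 mulf_neq0// invr_eq0.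
have x1 : x^-1 != 0 by rewrite invr_eq0.
have [s [b' [s0 Phib' sb]]] := scale_root (PsiPhi _ bPsi) k0.
have [t [c' [t0 Phic' tc]]] := scale_root (PsiPhi _ cPsi) x1.
have scaled (k l : R) v w : k != 0 -> k *: v = l *: w -> v \notin <[a]>%VS ->
    w \notin <[a]>%VS.
  move=> kn0 kv; apply: contra => wa.
  by rewrite -(scalerK (a := k) _ v) ?unitfE// kv !memvZ.
exists b', c', s, t; split; split=> //; last by rewrite -sb -tc.
- exact: scaled k0 sb ba.
- exact: scaled x1 tc ca.
Qed.

(** Take a Borel set containing the [b] and [c] of [root_between], hence [a]. A co-minimal [B2]
    containing [a] meets it only on the line of [a], so the functional of [B2] is negative at [b]
    and [c], hence at [a], a contradiction. *)
Lemma exists_core a : a \in Phi -> exists B, Borel_set Phi B /\ a \in core Phi B.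
Proof.
move=> Phia; have [b [c [s [t [[Phib Phic ba ca] [s0 t0 aE]]]]]] := root_between Phia.
have b0 := root_neq0 Phib; have a0 := root_neq0 Phia.
have cb : c \notin <[b]>%VS.
  apply: contra ba => cb; apply: vline_sym => //.
  by rewrite aE memvD// memvZ// memv_line.
have [g [gb gc]] := positive_functional2 b0 cb.
(* Nonvanishing on the differences makes [f] injective on [Phi], as general position demands. *)
pose diffs := [seq x - y | x <- Phi, y <- [seq y <- Phi | y != x]].
have [|f [fvs fws]] := @generic_functional _ _ g [:: b; c] (Phi ++ diffs).
  rewrite mem_cat negb_or; apply/andP; split; first by have [] := rootPhi.
  apply/allpairsPdep => -[x [y [_]]]; rewrite mem_filter => /andP[yx _] /esym/eqP.
  by rewrite subr_eq0 eq_sym (negbTE yx).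
have fb : 0 < f b by apply: fws; rewrite // !inE eqxx.
have fc : 0 < f c by apply: fws; rewrite // !inE eqxx orbT.
have comb (h : {linear V -> R^o}) : h a = s * h b + t * h c.
  by rewrite {1}aE linearD !linearZ.
exists [fset x in Phi | (0 : R) < f x]%fset; split.
  exists f => //; split=> [x Phix|x y Phix Phiy xy].
    by apply: fvs; rewrite mem_cat Phix.
  rewrite -subr_eq0 -linearB; apply: fvs; rewrite mem_cat; apply/orP; right.
  by apply/allpairsPdep; exists x, y; rewrite mem_filter Phiy eq_sym xy.
have fa : 0 < f a.
  by have := comb f; have := mulr_gt0 s0 fb; have := mulr_gt0 t0 fc; lra.
rewrite /core in_fsetD /boundary !inE Phia fa !andbT.
apply/negP => /asboolP[B2 [[f2 [gp _] B2E] dim1 aB2]].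
set B1 := [fset x in Phi | _]%fset in dim1 aB2.
have line x : x \in (B1 `&` B2)%fset -> x \in <[a]>%VS.
  move=> xB; suff <- : <<(B1 `&` B2)%fset>>%VS = <[a]>%VS by rewrite memv_span.
  apply/esym/eqP; rewrite eqEdim dim_vline a0 dim1 andbT.
  by rewrite -memvE memv_span.
have neg x : x \in Phi -> 0 < f x -> x \notin <[a]>%VS -> f2 x < 0.
  move=> Phix fx xa; rewrite lt_def [_ == _]eq_sym gp//= leNgt; apply: contra xa => f2x.
  by apply: line; rewrite in_fsetI B2E !inE Phix fx f2x.
have f2a : 0 < f2 a by move: aB2; rewrite in_fsetI B2E !inE => /andP[_ /andP[]].
have := comb f2; have f2b := neg b Phib fb ba; have f2c := neg c Phic fc ca.
have : s * f2 b < 0 by rewrite pmulr_rlt0.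
have : t * f2 c < 0 by rewrite pmulr_rlt0.
lra.
Qed.

End Cores.

(** * Crossing all walls along a line of functionals *)

Section Path.
Set Implicit Arguments.
Unset Strict Implicit.
Variables (R : realType) (V : vectType R) (Phi : {fset V}).
Variables (G : groupType) (K : V -> set G).
Hypothesis rootPhi : root_system Phi.
Hypothesis regPhi : regular_root_system Phi.
Hypothesis gradedK : strongly_graded_by Phi K.

Lemma generated_subgroupP (A : set G) : is_subgroup (generated_subgroup A).
Proof.
split=> [M [[M1 _] _] //|x y Ax Ay M MA].
by have [[_ MV] _] := MA; apply: MV; [exact: Ax|exact: Ay].
Qed.

(** A root [c] on the line of [a] is in the core of some [B], so strong grading expresses [K c]
    through [K b] with [b] in [B] not a positive multiple of [c]. The functional of [B] is positive
    at both, so [b] is not a negative multiple either. *)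
Lemma off_line_generates a : a \in Phi -> forall g,
  generated_subgroup [set h | exists c, [/\ c \in Phi, c \notin <[a]>%VS & K c h]] g.
Proof.
move=> Phia g; set A := [set h | _].
have [[_ gen _] strong] := gradedK.
have : generated_subgroup (\bigcup_(a in [set` Phi]) K a) g by rewrite gen.
apply; split; first exact: generated_subgroupP.
move=> h [c /= Phic Kch].
have [ca|ca] := boolP (c \in <[a]>%VS); last first.
  by move=> M [_ AM]; apply: AM; exists c.
have [B [BB cB]] := exists_core rootPhi regPhi Phic.
have := strong B c BB cB h Kch.
apply; split; first exact: generated_subgroupP.
move=> k [b [bB bc] Kbk] M [_ AM]; apply: AM; exists b.
have [f [gp _] BE] := BB.
have cB1 : c \in B by move: cB; rewrite /core in_fsetD => /andP[].
have fc : 0 < f c by move: cB1; rewrite BE !inE => /andP[].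
have [Phib fb] : b \in Phi /\ 0 < f b by move: bB; rewrite BE !inE => /andP[].
split=> //; apply/negP => /vlineP[x bx]; apply: bc.
have a0 := root_neq0 rootPhi Phia; have c0 := root_neq0 rootPhi Phic.
have /vlineP[y ay] := vline_sym c0 ca.
exists (x * y); last by rewrite -scalerA -ay.
move: fb; rewrite bx ay scalerA linearZ /= -[_ *: _]/(x * y * f c).
by rewrite pmulr_lgt0.
Qed.

Lemma count_lt (T : eqType) (P Q : pred T) (s : seq T) x :
  (forall y, P y -> Q y) -> x \in s -> Q x -> ~~ P x -> (count P s < count Q s)%N.
Proof.
move=> PQ + Qx nPx; elim: s => //= y s IH; rewrite in_cons => /predU1P[<-|xs].
  by rewrite Qx (negbTE nPx) add0n add1n ltnS sub_count.
rewrite -addnS leq_add//; last exact: IH.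
by have [/PQ->|] := boolP (P y).
Qed.

Variables (X : completeNormedModType R) (rho : G -> X -> X).
Hypothesis ucX : uniformly_convex X.
Hypothesis rhoA : affine_isometric_action rho.
Hypothesis relF : forall b, b \in Phi -> forall rho' : G -> X -> X,
  affine_isometric_action rho' -> exists z, forall k, K b k -> rho' k z = z.

Lemma uniform_displacement_roots : exists C : R, 0 <= C /\
  forall b k, b \in Phi -> K b k -> displacement_bound rho
    [set h | exists c, [/\ c \in Phi, c \notin <[b]>%VS & K c h]] k C.
Proof.
suff [C [C0 CP]] : exists C : R, 0 <= C /\
    forall b k, b \in (Phi : seq V) -> b \in Phi -> K b k -> displacement_bound rho
    [set h | exists c, [/\ c \in Phi, c \notin <[b]>%VS & K c h]] k C.
  by exists C; split=> // b k Phib; exact: CP.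
elim: (Phi : seq V) => [|b s [C [C0 CP]]]; first by exists 0.
have [Phib|nPhib] := boolP (b \in Phi); last first.
  exists C; split=> // c k; rewrite in_cons => /predU1P[->|sc]; last exact: CP.
  by rewrite (negbTE nPhib).
have [C' [C'0 C'P]] := uniform_displacement rhoA (off_line_generates Phib) (relF Phib).
exists (C + C'); split=> [|c k]; first exact: addr_ge0.
rewrite in_cons => /predU1P[->|sc] Phic Kk w r r0 wr; rewrite mulrDl.
  by rewrite (le_trans (C'P k Kk w r r0 wr))// lerDr mulr_ge0.
by rewrite (le_trans (CP c k sc Phic Kk w r r0 wr))// lerDl mulr_ge0.
Qed.

Section Walls.
Variables f0 h : 'Hom(V, R^o).
Hypothesis h0 : {in Phi, forall a, h a != 0}.
Hypothesis f0h : forall a b, a \in Phi -> b \in Phi -> b \notin <[a]>%VS ->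
  f0 a * h b != f0 b * h a :> R.

(** This is the [t] at which [f0 + t *: h] vanishes at [a]. By [f0h] roots on different lines have
    different times, so each wall met carries the roots of a single line. *)
Definition crossing_time (a : V) : R := - (f0 a / h a).
Local Notation tau := crossing_time.
Definition crossing_index (a : V) : nat := count (fun b => tau b < tau a) Phi.
Local Notation idx := crossing_index.

Lemma crossing_index_lt a b : a \in Phi -> (idx a < idx b)%N = (tau a < tau b).
Proof.
move=> Phia; apply/idP/idP => [|ab].
  rewrite ltnNge; apply: contraNT; rewrite -leNgt => ba; apply: sub_count => c /=.
  by move=> /lt_le_trans; exact.
apply: (count_lt (x := a)) => //; last by rewrite ltxx.
by move=> c /lt_trans; exact.
Qed.

Lemma wall_functionalE t a : a \in Phi -> (f0 + t *: h) a = h a * (t - tau a).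
Proof.
move=> /h0 ha; rewrite add_lfunE scale_lfunE -[_ *: _]/(t * h a) /tau opprK.
by rewrite mulrDr mulrCA divff// mulr1 [RHS]addrC (mulrC t).
Qed.

(* The chambers met by [f0 + t *: h] as [t] runs from -oo to +oo: [a] changes
   sign at [crossing_time a], and [crossing_index] ranks these times. *)
Definition path_chamber (i : nat) : set V := [set a | a \in Phi /\
  (0 < h a /\ (idx a < i)%N \/ h a < 0 /\ (i <= idx a)%N)].
Definition path_opposite (i : nat) : set V := [set a | a \in Phi /\
  (h a < 0 /\ (idx a < i)%N \/ 0 < h a /\ (i <= idx a)%N)].

(** For [x = h a] and [d] the time of the wall minus that of [a], the left side is membership in the
    chamber just before the wall, the right side membership in [path_chamber]. The other three
    identifications follow by changing signs of [x] and [d]. *)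
Lemma wall_sign (x d : R) : x != 0 ->
  (0 < x * d \/ x * d = 0 /\ 0 < - x) <-> (0 < x /\ 0 < d \/ x < 0 /\ d <= 0).
Proof.
rewrite neq_lt => /orP[x0|x0]; split.
- case=> [|[/eqP + _]]; first by rewrite nmulr_rgt0// => /ltW; right.
  by rewrite mulf_eq0 lt_eqF//= => /eqP ->; right.
- case=> [[/lt_trans/(_ x0)]|[_]]; first by rewrite ltxx.
  rewrite le_eqVlt => /predU1P[->|d0]; last by left; rewrite nmulr_rgt0.
  by right; rewrite mulr0 oppr_gt0.
- case=> [|[_]]; first by rewrite pmulr_rgt0//; left.
  by rewrite oppr_gt0 => /lt_trans/(_ x0); rewrite ltxx.
- case=> [[_ d0]|[/lt_trans/(_ x0)]]; first by left; rewrite pmulr_rgt0.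
  by rewrite ltxx.
Qed.

Section AtWall.
Variable a0 : V.
Hypothesis Phia0 : a0 \in Phi.
Local Notation f := (f0 + tau a0 *: h).

Lemma wall_functionalN a : a \in Phi -> (- f) a = - h a * (tau a0 - tau a).
Proof. by move=> Phia; rewrite opp_lfunE wall_functionalE// mulNr. Qed.

Lemma crossing_indexE a : a \in Phi ->
  [/\ (idx a < idx a0)%N = (0 < tau a0 - tau a),
      (idx a0 <= idx a)%N = (tau a0 - tau a <= 0),
      (idx a < (idx a0).+1)%N = (0 <= tau a0 - tau a) &
      ((idx a0).+1 <= idx a)%N = (tau a0 - tau a < 0)].
Proof.
move=> Phia; rewrite subr_gt0 subr_le0 subr_ge0 subr_lt0; split.
- exact: crossing_index_lt.
- by rewrite leqNgt crossing_index_lt// -leNgt.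
- by rewrite ltnS leqNgt crossing_index_lt// -leNgt.
- exact: crossing_index_lt.
Qed.

Lemma chamber_before : chamber Phi f (- h) = path_chamber (idx a0).
Proof.
apply/seteqP; split=> a [Phia H]; split=> //; move: H;
  have [-> -> _ _] := crossing_indexE Phia;
  by rewrite wall_functionalE// opp_lfunE => /(wall_sign _ (h0 Phia)).
Qed.

Lemma chamber_after : chamber Phi f h = path_chamber (idx a0).+1.
Proof.
apply/seteqP; split=> a [Phia H]; split=> //; move: H;
  have [_ _ -> ->] := crossing_indexE Phia; rewrite wall_functionalE//;
  have hN : - h a != 0 by rewrite oppr_eq0 h0.
all: move: (tau a0 - tau a) => d; have := wall_sign (- d) hN;
  rewrite mulrNN opprK !oppr_gt0 oppr_lt0 oppr_le0.
- by move=> -> [[? ?]|[? ?]]; [right|left].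
- by move=> H [?|?]; apply/H; [right|left].
Qed.

Lemma opposite_before : chamber Phi (- f) h = path_opposite (idx a0).
Proof.
apply/seteqP; split=> a [Phia H]; split=> //; move: H;
  have [-> -> _ _] := crossing_indexE Phia; rewrite wall_functionalN//;
  have hN : - h a != 0 by rewrite oppr_eq0 h0.
all: move: (tau a0 - tau a) => d; have := wall_sign d hN;
  rewrite opprK oppr_gt0 oppr_lt0.
- by move=> ->.
- by move=> H ?; apply/H.
Qed.

Lemma opposite_after : chamber Phi (- f) (- h) = path_opposite (idx a0).+1.
Proof.
apply/seteqP; split=> a [Phia H]; split=> //; move: H;
  have [_ _ -> ->] := crossing_indexE Phia;
  rewrite wall_functionalN// opp_lfunE.
all: move: (tau a0 - tau a) => d; have := wall_sign (- d) (h0 Phia);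
  rewrite mulrN -mulNr !oppr_gt0 oppr_le0.
- by move=> -> [[? ?]|[? ?]]; [right|left].
- by move=> H [?|?]; apply/H; [right|left].
Qed.

Lemma wall_displacement (C : R) :
  (forall b k, b \in Phi -> K b k -> displacement_bound rho
    [set g | exists c, [/\ c \in Phi, c \notin <[b]>%VS & K c g]] k C) ->
  forall b k, b \in Phi -> f b = 0 -> K b k -> displacement_bound rho
    [set g | exists c, [/\ c \in Phi, f c != 0 & K c g]] k C.
Proof.
move=> CP b k Phib fb Kk w s s0 ws; apply: (CP b k Phib Kk w s s0).
move=> g [c [Phic cb Kg]]; apply: ws; exists c; split=> //.
have hb := h0 Phib; have hc := h0 Phic.
apply: contra (f0h Phib Phic cb) => /eqP; move: fb.
rewrite !wall_functionalE// => /eqP; rewrite mulf_eq0 (negbTE hb)/= subr_eq0 => /eqP ->.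
move=> /eqP; rewrite mulf_eq0 (negbTE hc)/= subr_eq0 /tau eqr_opp eqr_div//.
Qed.

End AtWall.

Lemma path_step i : crossing K rho (path_chamber i) (path_opposite i)
  (path_chamber i.+1) (path_opposite i.+1).
Proof.
have [[a0 Phia0 <-]|noi] := pselect (exists2 a0, a0 \in Phi & idx a0 = i).
  have [C [C0 CP]] := uniform_displacement_roots.
  rewrite -chamber_before// -chamber_after// -opposite_before// -opposite_after//.
  have relK b : b \in Phi -> exists z, forall k, K b k -> rho k z = z.
    by move=> Phib; exact: relF.
  exact: (wall_crossing gradedK.1 ucX rhoA relK C0 (wall_displacement (a0 := a0) CP)).
(* Ranks skip values, since [a] and [- a] share a crossing time. At a skipped [i] no root changes
   side. *)
have neqi a : a \in Phi -> (idx a < i.+1)%N = (idx a < i)%N.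
  move=> Phia; rewrite ltnS leq_eqVlt; case: eqP => //= ai.
  by case: noi; exists a.
have eqi a : a \in Phi -> (i < idx a)%N = (i <= idx a)%N.
  by move=> Phia; rewrite ltnNge [RHS]leqNgt -ltnS neqi.
have -> : path_chamber i.+1 = path_chamber i.
  by apply/seteqP; split=> a [Phia H]; split=> //; move: H; rewrite neqi// eqi.
have -> : path_opposite i.+1 = path_opposite i.
  by apply/seteqP; split=> a [Phia H]; split=> //; move: H; rewrite neqi// eqi.
exact: crossing_refl.
Qed.

Lemma path_fixed_point : exists x, forall g, rho g x = x.
Proof.
have path i : crossing K rho (path_chamber 0) (path_opposite 0)
    (path_chamber i) (path_opposite i).
  elim: i => [|i IH]; first exact: crossing_refl.
  exact: crossing_trans IH (path_step i).
(* At index 0 no root has been crossed and at [(size Phi).+1] all have, so the two ends are the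
   negative and the positive roots of [h], and the path exchanges them. *)
have idx_max a : (idx a < (size Phi).+1)%N by rewrite ltnS count_size.
have max_idx a : ((size Phi).+1 <= idx a)%N = false by rewrite leqNgt idx_max.
have end1 : path_chamber (size Phi).+1 = path_opposite 0.
  apply/seteqP; split=> a [Phia]; rewrite ?idx_max ?max_idx ?ltn0 ?leq0n.
    by move=> [[ha _]|[_]//]; split=> //; right.
  by move=> [[_]//|[ha _]]; split=> //; left; rewrite idx_max.
have end2 : path_opposite (size Phi).+1 = path_chamber 0.
  apply/seteqP; split=> a [Phia]; rewrite ?idx_max ?max_idx ?ltn0 ?leq0n.
    by move=> [[ha _]|[_]//]; split=> //; right.
  by move=> [[_]//|[ha _]]; split=> //; left; rewrite idx_max.
have := path (size Phi).+1; rewrite end1 end2 => opp.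
have relK b : b \in Phi -> exists z, forall k, K b k -> rho k z = z.
  by move=> Phib; exact: relF.
have [||x [Fx Fx']] := crossing_fixed_point rhoA opp.
- have [x Fx] := fixed_set_positive_roots gradedK.1 ucX rhoA relK (- h).
  exists x; apply: fixed_set_sub Fx => a [Phia]; rewrite ltn0 => -[[]//|[ha _]].
  by split=> //; rewrite opp_lfunE oppr_gt0.
- have [x Fx] := fixed_set_positive_roots gradedK.1 ucX rhoA relK h.
  by exists x; apply: fixed_set_sub Fx => a [Phia]; rewrite ltn0 => -[[]//|[ha _]].
exists x => g; apply: (fixed_generated rhoA (A := \bigcup_(a in [set` Phi]) K a)).
  move=> k [a /= Phia Ka]; have := h0 Phia; rewrite neq_lt => /orP[ha|ha].
    by apply: (Fx a) => //; split=> //; right.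
  by apply: (Fx' a) => //; split=> //; right.
by have [[_ -> _] _] := gradedK.
Qed.

End Walls.

Lemma strongly_graded_fixed_point : exists x, forall g, rho g x = x.
Proof.
have nPhi0 : 0 \notin (Phi : seq V) by have [] := rootPhi.
have [h [h0 _]] := generic_functional 0 [::] nPhi0.
(* These vectors are nonzero for roots on different lines; [f0] being nonzero on them is exactly
   what separates the crossing times. *)
pose minors := [seq h b *: a - h a *: b | a <- Phi, b <- [seq b <- Phi | b \notin <[a]>%VS]].
have [|f0 [f0h _]] := @generic_functional _ _ 0 [::] minors.
  apply/allpairsPdep => -[a [b [Phia]]]; rewrite mem_filter => /andP[ba Phib].
  move=> /esym/eqP; rewrite subr_eq0 => /eqP hab; move/negP: ba; apply.
  apply/vlineP; exists ((h a)^-1 * h b).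
  by rewrite -scalerA hab scalerA mulVf ?scale1r// h0.
apply: (path_fixed_point (f0 := f0) h0) => a b Phia Phib ba.
have f0E : f0 (h b *: a - h a *: b) = f0 a * h b - f0 b * h a :> R.
  by rewrite -scaleNr functional_comb mulNr mulrC (mulrC (h a)).
rewrite -subr_eq0 -f0E; apply: f0h.
by apply/allpairsPdep; exists a, b; rewrite mem_filter ba.
Qed.

End Path.

Theorem theorem7p7 (R : realType) (V : vectType R) (Phi : {fset V})
    (G : groupType) (K : V -> set G)
    (U : nonprincipal_ultrafilter) (C : completeNormedModType R -> Prop) :
  root_system Phi ->
  regular_root_system Phi ->
  strongly_graded_by Phi K ->
  (forall X : completeNormedModType R, C X -> uniformly_convex X) ->
  closed_under_ultraproducts U C \/
    (forall X : completeNormedModType R, C X <-> uniformly_convex X) ->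
  (forall a : V, a \in Phi -> relative_propertyF C (K a)) ->
  propertyF G C.
Proof.
move=> rootPhi regPhi gradedK uc _ relF X CX rho rhoA.
apply: (strongly_graded_fixed_point rootPhi regPhi gradedK (uc X CX) rhoA).
by move=> b Phib; exact: relF CX.
Qed.
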